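(* Let $n\ge 1$, let $A=\operatorname{Diag}(a_1I_{m_1},\dots,a_sI_{m_s})$ and $B=\operatorname{Diag}(b_1I_{n_1},\dots,b_tI_{n_t})$ be real $n\times n$ matrices with the $a_i$ pairwise distinct, the $b_j$ pairwise distinct, $m_i,n_j\ge 1$ and $\sum_i m_i=\sum_j n_j=n$. Let $f:O(n)\to\mathbb{R}$, $f(X)=\operatorname{Tr}(AXBX^T)$, and let $F=\{X\in O(n):(Df)(X)=0\}$ be its critical locus. For $X\in F$ and $M\in T_XO(n)$, the following are equivalent: (i) $M\in T_XF\subseteq T_XO(n)$. (ii) $AMBX^T+AXBM^T$ is symmetric. (iii) $MBX^T+XBM^T=\operatorname{Diag}(W_1,\dots,W_s)$ with each $W_i$ an $m_i\times m_i$ symmetric matrix. (iv) $AMBX^T+AXBM^T=MBX^TA+XBM^TA$. (v) $BX^TAM+BM^TAX=X^TAMB+M^TAXB$. (vi) $BX^TAM+BM^TAX$ is symmetric. (vii) $X^TAM+M^TAX=\operatorname{Diag}(U_1,\dots,U_t)$ with each $U_j$ an $n_j\times n_j$ symmetric matrix. (viii) $M\in\operatorname{Ker}H(X)$, where $H(X)$ is the Hessian of $f$ at $X$. In particular, the equivalence of (i) and (viii) implies that $f$ is Morse-Bott.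
   Context: $\operatorname{Diag}$ denotes a (block-)diagonal matrix. $T_XO(n)=\{M\in\mathbb{R}^{n\times n}: MX^T+XM^T=0\}$. The critical locus $F$ is a smooth submanifold of $O(n)$, with tangent space $T_XF$ at $X$. The Hessian $H(X)$ of $f$ at a critical point $X$ is the symmetric bilinear form on $T_XO(n)$ given by the second derivative of $f$ at $X$ (i.e. $H(X)(v,w)=\partial_u\partial_v' f(c(u,v'))|_{u=v'=0}$ for any smooth $c:\mathbb{R}^2\to O(n)$ near $0$ with $c(0,0)=X$, $\partial_uc(0,0)=v$, $\partial_{v'}c(0,0)=w$), and $\operatorname{Ker}H(X)=\{M: H(X)(M,N)=0\ \text{for all } N\in T_XO(n)\}$. A smooth function is Morse-Bott if its critical locus is a disjoint union of smooth submanifolds and at each critical point the kernel of the Hessian equals the tangent space of the critical locus. *)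

(* Defs.v *)
From HB Require Import structures.
From mathcomp Require Import all_boot all_order all_algebra.
From mathcomp Require Import all_classical all_reals all_analysis.

Set Implicit Arguments.
Unset Strict Implicit.
Unset Printing Implicit Defensive.

Import Order.TTheory GRing.Theory Num.Theory.
Import numFieldNormedType.Exports.

Local Open Scope classical_set_scope.
Local Open Scope ring_scope.

(* The set U is meant to be open.  Between finite-dimensional spaces, x |-> 'd g x
   is C^k iff x |-> 'd g x v is C^k for every v. *)
Fixpoint Ck_on (R : realType) (V W : normedModType R) (k : nat) (U : set V)
    (g : V -> W) : Prop :=
  match k with
  | 0%N => forall x, U x -> {for x, continuous g}
  | k'.+1 => (forall x, U x -> differentiable g x) /\
             (forall v : V, Ck_on k' U (fun x => 'd g x v : W))
  end.

Definition smooth_on (R : realType) (V W : normedModType R) (U : set V)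
    (g : V -> W) : Prop :=
  forall k, Ck_on k U g.

Definition orthogonal_group (R : realType) (n : nat) : set 'M[R]_n :=
  [set X | X *m X^T = 1%:M].

Definition tangent_O (R : realType) (n : nat) (X : 'M[R]_n) : set 'M[R]_n :=
  [set M | M *m X^T + X *m M^T = 0].

(* Velocities at X of the smooth curves drawn on S.  This is the tangent space
   of S at X when S is a submanifold. *)
Definition tangent_space (R : realType) (n : nat) (S : set 'M[R]_n)
    (X : 'M[R]_n) : set 'M[R]_n :=
  [set M | exists (U : set R) (c : R -> 'M[R]_n),
    [/\ open U, U 0, smooth_on U c, (forall t, U t -> S (c t)) &
        c 0 = X /\ derive1 c 0 = M]].

(* Functions on O(n) are given by functions on the ambient space of matrices;
   only their restriction to O(n) matters in the notions below, apart from the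
   requirement that the function be smooth. *)

(* S is a submanifold of O(n) of codimension k: near each of its points it is a
   regular level set of a smooth map from O(n) to R^k.  For Y in O(n), the
   differential at Y of the restriction of g to O(n) is the restriction of
   'd g Y to tangent_O Y. *)
Definition submanifold_O (R : realType) (n k : nat) (S : set 'M[R]_n) : Prop :=
  S `<=` @orthogonal_group R n /\
  forall X, S X -> exists (U : set 'M[R]_n) (g : 'M[R]_n -> 'rV[R]_k),
    [/\ open U, U X, smooth_on U g,
        S `&` U = [set Y | [/\ U Y, orthogonal_group Y & g Y = 0]] &
        forall Y, (S `&` U) Y ->
          forall w : 'rV[R]_k, exists2 M, tangent_O Y M & 'd g Y M = w].

Definition critical_locus (R : realType) (n : nat) (f : 'M[R]_n -> R) :
    set 'M[R]_n :=
  [set X | orthogonal_group X /\ forall M, tangent_O X M -> 'd f X M = 0 :> R].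

Definition adapted_surface (R : realType) (n : nat) (X v w : 'M[R]_n)
    (c : R * R -> 'M[R]_n) : Prop :=
  (exists U : set (R * R),
    [/\ open U, U (0, 0), smooth_on U c &
        forall p, U p -> orthogonal_group (c p)])
  /\ [/\ c (0, 0) = X, 'D_(1, 0) c (0, 0) = v & 'D_(0, 1) c (0, 0) = w].

(* At a critical point X and for tangent vectors v and w, the mixed derivative
   does not depend on the surface c, so that the set below is a singleton. *)
Definition hessian (R : realType) (n : nat) (f : 'M[R]_n -> R)
    (X v w : 'M[R]_n) : R :=
  get [set h | exists2 c : R * R -> 'M[R]_n, adapted_surface X v w c &
    h = 'D_(1, 0) (fun p => 'D_(0, 1) (f \o c) p : R) (0, 0)].

Definition ker_hessian (R : realType) (n : nat) (f : 'M[R]_n -> R)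
    (X : 'M[R]_n) : set 'M[R]_n :=
  [set M | tangent_O X M /\ forall N, tangent_O X N -> hessian f X M N = 0].

(* The union is a topological disjoint union: each C i is open in the critical
   locus (otherwise every set would be a disjoint union of points).  The pieces
   may have different dimensions. *)
Definition morse_bott (R : realType) (n : nat) (f : 'M[R]_n -> R) : Prop :=
  [/\ smooth_on setT f,
      (exists (I : Type) (C : I -> set 'M[R]_n) (k : I -> nat),
        [/\ trivIset setT C, critical_locus f = \bigcup_i C i,
            (forall i, exists2 U, open U & C i = critical_locus f `&` U) &
            forall i, submanifold_O (k i) (C i)]) &
      forall X, critical_locus f X ->
        ker_hessian f X = tangent_space (critical_locus f) X].

Definition block_diag (R : realType) (n s : nat) (p : 'I_s -> nat)
    (E : (\sum_i p i)%N = n) (W : forall i, 'M[R]_(p i)) : 'M[R]_n :=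
  castmx (E, E) (\mxdiag_i W i).

Definition trace_fun (R : realType) (n : nat) (A B X : 'M[R]_n) : R :=
  \tr (A *m X *m B *m X^T).

(* Main.v *)
Require Import Defs.
From HB Require Import structures.
From mathcomp Require Import all_boot all_order all_algebra.
From mathcomp Require Import ring.
From mathcomp Require Import all_classical all_reals all_analysis.

Set Implicit Arguments.
Unset Strict Implicit.
Unset Printing Implicit Defensive.

Import Order.TTheory GRing.Theory Num.Theory.
Import numFieldNormedType.Exports.

Local Open Scope classical_set_scope.
Local Open Scope ring_scope.

(* Write C = X B X^T.  A point X of O(n) is critical iff [A, C] = 0, and for a
   tangent vector M = W X, with W skew, each of the conditions (ii)-(viii) is
   [A, [W, C]] = 0: the Jacobi identity gives (v), and the Hessian is
   (W X, V X) |-> tr (V [[W, C], A]).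

   If [A, [W, C]] = 0, then pinching W by the spectral projections of A writes
   W = W1 + W2, with W1 skew and commuting with A, and W2 skew and commuting
   with C; the product of the Cayley transforms of t W1 / 2 and t W2 / 2, applied
   to X, is then a curve of critical points with velocity W X.

   The critical locus is stratified by the rank of W |-> [A, [W, C]].  Let pi_X
   send a matrix to its off-diagonal part for the spectral projections of C.
   Near a critical point X, the critical points Y are the solutions in O(n) of
   [A, pi_X (Y B Y^T)] = 0: for such a Y, the commutator [A, Y B Y^T] is block
   diagonal for the projections of X and has zero diagonal blocks for those of Y,
   and these conditions are transversal when Y is close to X.  The same
   transversality makes this equation a submersion onto its range, and the rank
   locally constant on the critical locus. *)

(** * Smooth maps *)

Lemma Ck_on_sub (R : realType) (V W : normedModType R) k (U U' : set V)
    (g : V -> W) : U' `<=` U -> Ck_on k U g -> Ck_on k U' g.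
Proof.
move=> sU; elim: k g => [|k IH] g /=; first by move=> gU x /sU; exact: gU.
by move=> [dg dgv]; split=> [x /sU|v]; [exact: dg | exact: IH].
Qed.

Lemma Ck_onW (R : realType) (V W : normedModType R) k (U : set V)
    (g : V -> W) : Ck_on k.+1 U g -> Ck_on k U g.
Proof.
elim: k g => [|k IH] g [dg dgv].
  by move=> x /dg; exact: differentiable_continuous.
by split=> // v; exact: IH.
Qed.

Section Smooth.
Variables (R : realType) (V : normedModType R).
Local Notation Ck k := (@Ck_on R V _ k setT).
Local Notation smooth := (@smooth_on R V _ setT).

Lemma Ck_cst (W : normedModType R) k (c : W) : Ck k (cst c).
Proof.
elim: k c => [|k IH] c /=; first by move=> x _; exact: cst_continuous.
split=> [x _|v]; first exact: differentiable_cst.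
rewrite (_ : (fun x => _) = cst 0); first exact: IH.
by apply/funext=> x; rewrite diff_cst.
Qed.

Lemma smooth_cst (W : normedModType R) (c : W) : smooth (cst c).
Proof. by move=> k; exact: Ck_cst. Qed.

Lemma smooth_lin (W : normedModType R) (l : {linear V -> W}) :
  continuous l -> smooth l.
Proof.
move=> cl [|k] /=; first by move=> x _; exact: cl.
split=> [x _|v]; first exact: linear_differentiable.
rewrite (_ : (fun x => _) = cst (l v)); first exact: Ck_cst.
by apply/funext=> x; rewrite diff_lin.
Qed.

Lemma Ck_lin_comp (W W' : normedModType R) (l : {linear W -> W'}) k
    (g : V -> W) : continuous l -> Ck k g -> Ck k (l \o g).
Proof.
move=> cl; elim: k g => [|k IH] g /=.
  by move=> cg x _; apply: continuous_comp; [exact: cg|exact: cl].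
move=> [dg dgv]; split=> [x _|v].
  by apply: differentiable_comp; [exact: dg|exact: linear_differentiable].
rewrite (_ : (fun x => _) = l \o (fun x => 'd g x v)); first exact: IH.
apply/funext=> x; rewrite diff_comp /=; [|exact: dg|exact: linear_differentiable].
by rewrite diff_lin.
Qed.

Lemma smooth_lin_comp (W W' : normedModType R) (l : {linear W -> W'})
    (g : V -> W) : continuous l -> smooth g -> smooth (l \o g).
Proof. by move=> cl sg k; apply: Ck_lin_comp. Qed.

Lemma Ck_add (W : normedModType R) k (f g : V -> W) :
  Ck k f -> Ck k g -> Ck k (f \+ g).
Proof.
elim: k f g => [|k IH] f g /=.
  by move=> cf cg x xU; apply: continuousD; [exact: cf|exact: cg].
move=> [df dfv] [dg dgv]; split=> [x xU|v].
  by apply: differentiableD; [exact: df|exact: dg].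
rewrite (_ : (fun x => _) = (fun x => 'd f x v) \+ (fun x => 'd g x v)).
  exact: IH.
by apply/funext=> x; rewrite diffD //=; [exact: df|exact: dg].
Qed.

Lemma smooth_add (W : normedModType R) (f g : V -> W) :
  smooth f -> smooth g -> smooth (f \+ g).
Proof. by move=> sf sg k; apply: Ck_add. Qed.

Lemma smooth_sum (W : normedModType R) (I : Type) (r : seq I) (P : pred I)
    (f : I -> V -> W) :
  (forall i, P i -> smooth (f i)) -> smooth (fun x => \sum_(i <- r | P i) f i x).
Proof.
move=> sf; elim: r => [|i r IH].
  rewrite (_ : (fun x => _) = cst 0); first exact: smooth_cst.
  by apply/funext=> x; rewrite big_nil.
have [Pi|nPi] := boolP (P i); last first.
  rewrite (_ : (fun x => _) = (fun x => \sum_(j <- r | P j) f j x)) //.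
  by apply/funext=> x; rewrite big_cons (negbTE nPi).
rewrite (_ : (fun x => _) = f i \+ (fun x => \sum_(j <- r | P j) f j x)).
  by apply: smooth_add => //; exact: sf.
by apply/funext=> x; rewrite big_cons Pi.
Qed.

(** By the Leibniz rule the derivative pairs each factor with the derivative of the other, so the
    induction uses the undifferentiated factors at one order less. *)
Lemma Ck_mul k (f g : V -> R) : Ck k f -> Ck k g -> Ck k (f \* g).
Proof.
elim: k f g => [|k IH] f g.
  by move=> /= cf cg x xU; apply: continuousM; [exact: cf|exact: cg].
move=> Cf Cg; have [df dfv] := Cf; have [dg dgv] := Cg; split=> [x xU|v].
  by apply: differentiableM; [exact: df|exact: dg].
rewrite (_ : (fun x => _) = (f \* (fun x => 'd g x v)) \+
    (g \* (fun x => 'd f x v))).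
  by apply: Ck_add; [apply: IH (Ck_onW Cf) (dgv v)|apply: IH (Ck_onW Cg) (dfv v)].
by apply/funext=> x; have dfx := df x I; have dgx := dg x I; rewrite diffM.
Qed.

Lemma smooth_mul (f g : V -> R) : smooth f -> smooth g -> smooth (f \* g).
Proof. by move=> sf sg k; apply: Ck_mul. Qed.

Lemma smooth_prod (I : Type) (r : seq I) (f : I -> V -> R) :
  (forall i, smooth (f i)) -> smooth (fun x => \prod_(i <- r) f i x).
Proof.
move=> sf; elim: r => [|i r IH].
  rewrite (_ : (fun x => _) = cst 1); first exact: smooth_cst.
  by apply/funext=> x; rewrite big_nil.
rewrite (_ : (fun x => _) = f i \* (fun x => \prod_(j <- r) f j x)).
  exact: smooth_mul.
by apply/funext=> x; rewrite big_cons.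
Qed.

(** The derivative of [1/f] is [- f^-2 df], which contains [1/f] again; its regularity at order [k]
    therefore gives order [k+1]. *)
Lemma smooth_inv (f : V -> R) : (forall x, f x != 0) -> smooth f ->
  smooth (fun x => (f x)^-1).
Proof.
move=> f0 sf; elim=> [|k IH].
  by move=> x xU; apply: continuousV => //; exact: (sf 0%N).
have [df dfv] := sf k.+1; split=> [x xU|v].
  by apply: differentiableV => //; exact: df.
rewrite (_ : (fun x => _) = cst (-1) \* (((fun x => (f x)^-1) \*
    (fun x => (f x)^-1)) \* (fun x => 'd f x v))).
  apply: Ck_mul; first exact: Ck_cst.
  by apply: Ck_mul; [exact: Ck_mul|exact: dfv].
apply/funext=> x; have dfx := df x I; rewrite diffV //=.
by rewrite mulN1r -[_ *: _]/(_ * _) mulNr -exprVn expr2.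
Qed.

Lemma smooth_coord m n (M : V -> 'M[R]_(m, n)) i j :
  smooth M -> smooth (fun x => M x i j).
Proof.
move=> sM.
have lin : linear (fun N : 'M[R]_(m, n) => N i j) by move=> c N N'; rewrite !mxE.
pose L := GRing.isLinear.Build _ _ _ _ _ lin.
pose l : {linear 'M[R]_(m, n) -> R} := HB.pack (fun N : 'M[R]_(m, n) => N i j) L.
exact: (@smooth_lin_comp _ _ l M (@coord_continuous _ _ _ i j) sM).
Qed.

Lemma smooth_scalel (W : normedModType R) (f : V -> R) (w : W) :
  smooth f -> smooth (fun x => f x *: w).
Proof.
move=> sf.
have lin : linear (fun c : R => c *: w).
  by move=> c x y; rewrite scalerDl scalerA.
pose L := GRing.isLinear.Build _ _ _ _ _ lin.
pose l : {linear R -> W} := HB.pack (fun c : R => c *: w) L.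
exact: (@smooth_lin_comp _ _ l f (@scalel_continuous _ _ w) sf).
Qed.

Lemma smooth_mx m n (M : V -> 'M[R]_(m, n)) :
  (forall i j, smooth (fun x => M x i j)) -> smooth M.
Proof.
move=> sM; rewrite (_ : M = fun x => \sum_i \sum_j M x i j *: delta_mx i j).
  by do 2!(apply: smooth_sum => ? _); exact: smooth_scalel.
by apply/funext=> x; exact: matrix_sum_delta.
Qed.

Lemma smooth_mulmx m n p (M : V -> 'M[R]_(m, n)) (N : V -> 'M[R]_(n, p)) :
  smooth M -> smooth N -> smooth (fun x => M x *m N x).
Proof.
move=> sM sN; apply: smooth_mx => i j.
rewrite (_ : (fun x => _) = fun x => \sum_k M x i k * N x k j); last first.
  by apply/funext=> x; rewrite mxE.
by apply: smooth_sum => k _; apply: smooth_mul; exact: smooth_coord.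
Qed.

Lemma smooth_trmx m n (M : V -> 'M[R]_(m, n)) :
  smooth M -> smooth (fun x => (M x)^T).
Proof.
move=> sM; apply: smooth_mx => i j.
rewrite (_ : (fun x => _) = fun x => M x j i); first exact: smooth_coord.
by apply/funext=> x; rewrite mxE.
Qed.

Lemma smooth_tr n (M : V -> 'M[R]_n) : smooth M -> smooth (fun x => \tr (M x)).
Proof. by move=> sM; apply: smooth_sum => i _; exact: smooth_coord. Qed.

Lemma smooth_det n (M : V -> 'M[R]_n) :
  (forall i j, smooth (fun x => M x i j)) -> smooth (fun x => \det (M x)).
Proof.
move=> sM; apply: smooth_sum => s _; apply: smooth_mul; first exact: smooth_cst.
exact: smooth_prod.
Qed.

(** Cramer's rule: each entry is a cofactor, polynomial in the entries, times the inverse of a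
    determinant that vanishes nowhere. *)
Lemma smooth_invmx n (M : V -> 'M[R]_n) : (forall x, M x \in unitmx) ->
  smooth M -> smooth (fun x => invmx (M x)).
Proof.
move=> uM sM; apply: smooth_mx => i j.
rewrite (_ : (fun x => _) = (fun x => (\det (M x))^-1) \*
    (cst ((-1) ^+ (j + i)) \* fun x => \det (row' j (col' i (M x))))); last first.
  by apply/funext=> x; rewrite /invmx uM !mxE.
have sMij i' j' := smooth_coord i' j' sM.
apply: smooth_mul; last first.
  apply: smooth_mul; first exact: smooth_cst.
  apply: smooth_det => i' j'.
  rewrite (_ : (fun x => _) = fun x => M x (lift j i') (lift i j')) //.
  by apply/funext=> x; rewrite !mxE.
apply: smooth_inv; last exact: smooth_det.
by move=> x; rewrite -unitfE -unitmxE.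
Qed.

End Smooth.

Lemma smooth_on_differentiable (R : realType) (V W : normedModType R) (U : set V)
    (g : V -> W) x : smooth_on U g -> U x -> differentiable g x.
Proof. by move=> /(_ 1%N)[dg _]; exact: dg. Qed.

Lemma smooth_on_diff (R : realType) (V W : normedModType R) (U : set V)
    (g : V -> W) v : smooth_on U g -> smooth_on U (fun x => 'd g x v : W).
Proof. by move=> sg k; have [_] := sg k.+1; exact. Qed.

Lemma smooth_id (R : realType) (V : normedModType R) :
  smooth_on setT (@idfun V).
Proof. by apply: (@smooth_lin _ _ _ (@idfun V : {linear V -> V})) => x. Qed.

(** * Directional derivatives of matrix-valued maps *)

Section Derive.
Variables (R : realType) (V : normedModType R).
Implicit Types (x v : V).

Lemma differentiable_is_derive (W : normedModType R) (f : V -> W) x v :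
  differentiable f x -> is_derive x v f ('d f x v).
Proof. by move=> df; apply: DeriveDef; [exact: diff_derivable|exact: deriveE]. Qed.

Lemma is_derive_mxP m n (M : V -> 'M[R]_(m, n)) dM x v :
  is_derive x v M dM <->
  forall i j, is_derive x v (fun y => M y i j) (dM i j).
Proof.
split=> [[dMx <-] i j|dMij].
  by rewrite derive_mx // mxE; apply/derivableP/(derivable_mxP M x v).1.
have dMx : derivable M x v by apply/derivable_mxP => i j; have [] := dMij i j.
apply: DeriveDef => //; rewrite derive_mx //; apply/matrixP => i j.
by rewrite mxE; have [] := dMij i j.
Qed.

Lemma is_derive_bigsum (I : Type) (r : seq I) (P : pred I)
    (W : normedModType R)
    (h : I -> V -> W) (dh : I -> W) x v :
  (forall i, P i -> is_derive x v (h i) (dh i)) ->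
  is_derive x v (fun y => \sum_(i <- r | P i) h i y) (\sum_(i <- r | P i) dh i).
Proof.
move=> dhx; rewrite (_ : (fun y => _) = \sum_(i <- r | P i) h i); last first.
  by apply/funext=> y; rewrite fct_sumE.
by elim/big_ind2 : _ => // [|] *; [exact: is_derive_cst|exact: is_deriveD].
Qed.

Lemma is_derive_mulmx m n p (M : V -> 'M[R]_(m, n)) (N : V -> 'M[R]_(n, p))
    dM dN x v : is_derive x v M dM -> is_derive x v N dN ->
  is_derive x v (fun y => M y *m N y) (dM *m N x + M x *m dN).
Proof.
move=> /is_derive_mxP dMx /is_derive_mxP dNx; apply/is_derive_mxP => i j.
rewrite (_ : (fun y => _) = fun y => \sum_k M y i k * N y k j); last first.
  by apply/funext=> y; rewrite mxE.
rewrite !mxE -big_split /=; apply: is_derive_bigsum => k _.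
apply: is_derive_eq (is_deriveM (dMx i k) (dNx k j)) _.
by rewrite addrC -[_ *: dM i k]/(_ * _) -[_ *: dN k j]/(_ * _) [N x k j * _]mulrC.
Qed.

Lemma is_derive_trmx m n (M : V -> 'M[R]_(m, n)) dM x v :
  is_derive x v M dM -> is_derive x v (fun y => (M y)^T) dM^T.
Proof.
move=> /is_derive_mxP dMx; apply/is_derive_mxP => i j; rewrite mxE.
by rewrite (_ : (fun y => _) = fun y => M y j i) //; apply/funext=> y; rewrite mxE.
Qed.

Lemma is_derive_mxtrace n (M : V -> 'M[R]_n) dM x v :
  is_derive x v M dM -> is_derive x v (fun y => \tr (M y)) (\tr dM).
Proof. by move=> /is_derive_mxP dMx; apply: is_derive_bigsum => i _. Qed.

Lemma is_derive_mulmxl m n p (A : 'M[R]_(m, n)) (N : V -> 'M[R]_(n, p)) dN x v :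
  is_derive x v N dN -> is_derive x v (fun y => A *m N y) (A *m dN).
Proof.
move=> dNx; apply: is_derive_eq (is_derive_mulmx (is_derive_cst A x v) dNx) _.
by rewrite mul0mx add0r.
Qed.

Lemma is_derive_mulmxr m n p (N : V -> 'M[R]_(m, n)) (A : 'M[R]_(n, p)) dN x v :
  is_derive x v N dN -> is_derive x v (fun y => N y *m A) (dN *m A).
Proof.
move=> dNx; apply: is_derive_eq (is_derive_mulmx dNx (is_derive_cst A x v)) _.
by rewrite mulmx0 addr0.
Qed.

(** Serves to differentiate an identity that holds near a point. *)
Lemma is_derive_uniq (W : normedModType R) (f g : V -> W) x v df dg :
  (\near x, f x = g x) -> is_derive x v f df -> is_derive x v g dg -> df = dg.
Proof.
by move=> fg fx gx; have [_ <-] := near_eq_is_derive fg fx; have [] := gx.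
Qed.

(** The two factors may be different maps because the Hessian involves products of a surface with
    its partial derivative. *)
Lemma is_derive_quad n (A B : 'M[R]_n) (c c' : V -> 'M[R]_n) dc dc' x v :
  is_derive x v c dc -> is_derive x v c' dc' ->
  is_derive x v (fun y => A *m c y *m B *m (c' y)^T)
    (A *m dc *m B *m (c' x)^T + A *m c x *m B *m dc'^T).
Proof.
move=> dcx dc'x; apply: is_derive_mulmx; last exact: is_derive_trmx.
by apply: is_derive_mulmxr; exact: is_derive_mulmxl.
Qed.

Lemma is_derive_trace_fun n (A B : 'M[R]_n) (c : V -> 'M[R]_n) dc x v :
  is_derive x v c dc -> is_derive x v (fun y => trace_fun A B (c y))
    (\tr (A *m dc *m B *m (c x)^T + A *m c x *m B *m dc^T)).
Proof. by move=> dcx; apply: is_derive_mxtrace; exact: is_derive_quad. Qed.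

End Derive.

Lemma smooth_trace_fun (R : realType) n (A B : 'M[R]_n) :
  smooth_on setT (trace_fun A B).
Proof.
have sid := @smooth_id R 'M[R]_n.
have sc C := @smooth_cst R 'M[R]_n 'M[R]_n C.
apply: smooth_tr; apply: smooth_mulmx; last exact: smooth_trmx.
exact: smooth_mulmx (smooth_mulmx (sc A) sid) (sc B).
Qed.

Lemma diff_trace_fun (R : realType) n (A B X M : 'M[R]_n) :
  'd (trace_fun A B) X M = \tr (A *m M *m B *m X^T + A *m X *m B *m M^T) :> R.
Proof.
rewrite -deriveE; last exact: smooth_on_differentiable (smooth_trace_fun A B) I.
by have [_ ->] := is_derive_trace_fun A B (is_derive_id X M).
Qed.
(** * The Cayley transform *)

Section Cayley.
Variables (R : realType) (n : nat).
Implicit Types K : 'M[R]_n.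

Lemma row_norm0 m (v : 'rV[R]_m) : v *m v^T = 0 -> v = 0.
Proof.
move=> /matrixP/(_ 0 0); rewrite !mxE => /eqP; rewrite psumr_eq0; last first.
  by move=> i _; rewrite mxE -expr2 sqr_ge0.
move=> /allP v0; apply/rowP => i; rewrite mxE.
have := v0 i; rewrite mem_index_enum => /(_ isT) /=.
by rewrite mxE mulf_eq0 orbb => /eqP.
Qed.

(** If [v = v K], then [v v^T = v K v^T] is both symmetric and, as [K] is skew, antisymmetric; hence
    it is zero. *)
Lemma skew_1B_unit K : K^T = - K -> 1%:M - K \in unitmx.
Proof.
move=> Kskew; rewrite -row_free_unit; apply: inj_row_free => v.
rewrite mulmxBr mulmx1 => /eqP; rewrite subr_eq0 => /eqP vK.
apply: row_norm0.
have vv : v *m v^T = v *m K *m v^T by rewrite -vK.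
have : (v *m v^T)^T = - (v *m v^T).
  by rewrite {1}vv !trmx_mul trmxK Kskew mulNmx mulmxN mulmxA -vv.
rewrite trmx_mul trmxK => /eqP; rewrite -addr_eq0 -mulr2n -scaler_nat.
by rewrite scaler_eq0 pnatr_eq0 => /eqP.
Qed.

(** Plays the part of the exponential: it sends skew matrices to orthogonal ones, and, being
    rational in [K], it inherits smoothness from matrix inversion. *)
Definition cayley K : 'M[R]_n := (1%:M + K) *m invmx (1%:M - K).

Lemma cayleyE K : K^T = - K -> cayley K *m (1%:M - K) = 1%:M + K.
Proof. by move=> Ks; rewrite mulmxKV // skew_1B_unit. Qed.

Lemma cayley0 : cayley 0 = 1%:M.
Proof. by rewrite /cayley addr0 subr0 invmx1 mulmx1. Qed.

Lemma invmx_comm (M N : 'M[R]_n) : M *m N = N *m M -> invmx M *m N = N *m invmx M.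
Proof.
(* [invmx] returns a singular matrix unchanged, so the identity holds there too. *)
move=> MN; have [uM|nuM] := boolP (M \in unitmx); last by rewrite !invmx_out.
by apply: (can_inj (mulKmx uM)); rewrite mulKVmx // !mulmxA MN mulmxK.
Qed.

Lemma cayley_comm K N : K *m N = N *m K -> cayley K *m N = N *m cayley K.
Proof.
move=> KN; rewrite /cayley -mulmxA invmx_comm.
  by rewrite !mulmxA mulmxDl mulmxDr mul1mx mulmx1 KN.
by rewrite mulmxBl mulmxBr mul1mx mulmx1 KN.
Qed.

Lemma cayley_orthogonal K : K^T = - K -> orthogonal_group (cayley K).
Proof.
move=> Ks; have uK := skew_1B_unit Ks.
have uK' : 1%:M + K \in unitmx.
  by rewrite -unitmx_tr linearD /= trmx1 Ks skew_1B_unit.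
rewrite /orthogonal_group /= {2}/cayley trmx_mul trmx_inv linearB linearD /=.
rewrite trmx1 Ks opprK.
(* The transpose is [(1 + K)^-1 (1 - K)]; exchanging these commuting factors puts [1 - K] next to
   [cayley K]. *)
rewrite invmx_comm; last first.
  by rewrite mulmxBr mulmx1 mulmxBl mul1mx mulmxDl mulmxDr mul1mx mulmx1.
by rewrite mulmxA cayleyE // mulmxV.
Qed.

Section Smooth.
Variables (V : normedModType R) (K : V -> 'M[R]_n).
Hypotheses (Ks : forall x, (K x)^T = - K x) (sK : smooth_on setT K).

Lemma smooth_cayley : smooth_on setT (fun x => cayley (K x)).
Proof.
have s1 := @smooth_cst R V 'M[R]_n 1%:M.
apply: smooth_mulmx; first exact: smooth_add.
apply: smooth_invmx; first by move=> x; exact: skew_1B_unit.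
rewrite (_ : (fun x => _) = cst 1%:M \+ (fun x => (-1)%:M *m K x)).
  by apply: smooth_add => //; apply: smooth_mulmx => //; exact: smooth_cst.
by apply/funext=> x /=; rewrite mul_scalar_mx scaleN1r.
Qed.

(** Differentiating [cayley K (1 - K) = 1 + K] at a zero of [K] gives [dC - dK = dK], without
    computing the derivative of an inverse. *)
Lemma is_derive_cayley x v dK : K x = 0 -> is_derive x v K dK ->
  is_derive x v (fun y => cayley (K y)) (dK *+ 2).
Proof.
move=> K0 dKx.
have [dC dCx] : exists dC, is_derive x v (fun y => cayley (K y)) dC.
  exists ('d (fun y => cayley (K y)) x v); apply: differentiable_is_derive.
  exact: smooth_on_differentiable smooth_cayley I.
have h1 : is_derive x v (fun y => 1%:M + K y) dK.
  by apply: is_derive_eq (is_deriveD (is_derive_cst 1%:M x v) dKx) _; rewrite add0r.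
have h2 : is_derive x v (fun y => 1%:M - K y) (- dK).
  by apply: is_derive_eq (is_deriveB (is_derive_cst 1%:M x v) dKx) _; rewrite sub0r.
have h3 := is_derive_mulmx dCx h2.
suff -> : dK *+ 2 = dC by [].
have := is_derive_uniq _ h3 h1.
rewrite K0 cayley0 subr0 mulmx1 mul1mx => e.
rewrite mulr2n -{1}e ?subrK //; apply: nearW => y; exact: cayleyE.
Qed.

End Smooth.
End Cayley.

(** * Commutators and spectral families *)

Lemma addmxE (R : nmodType) m n (M N : 'M[R]_(m, n)) i j :
  (M + N) i j = M i j + N i j.
Proof. by rewrite mxE. Qed.

Lemma oppmxE (R : zmodType) m n (M : 'M[R]_(m, n)) i j : (- M) i j = - M i j.
Proof. by rewrite mxE. Qed.

(** With [mx_abel], proves noncommutative identities: once products are distributed, the entries of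
    the monomials are atoms and [ring] only compares their sums. *)
Ltac mx_expand :=
  rewrite ?(mulmxBl, mulmxBr, mulmxDl, mulmxDr, mulmxN, mulNmx, mulmxA).
Ltac mx_abel := apply/matrixP => ? ?; rewrite ?(addmxE, oppmxE); ring.

Section Bracket.
Variables (R : comNzRingType) (n : nat).
Implicit Types A B X Y Z : 'M[R]_n.

Definition lie X Y : 'M[R]_n := X *m Y - Y *m X.

Lemma lieP X Y : lie X Y = 0 <-> X *m Y = Y *m X.
Proof. by split=> [/eqP|XY]; [rewrite subr_eq0 => /eqP | rewrite /lie XY subrr]. Qed.

Lemma lieC X Y : lie X Y = - lie Y X.
Proof. by rewrite /lie opprB. Qed.

Lemma lieBl X Y Z : lie (X - Y) Z = lie X Z - lie Y Z.
Proof. by rewrite /lie; mx_expand; mx_abel. Qed.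

Lemma lieBr X Y Z : lie X (Y - Z) = lie X Y - lie X Z.
Proof. by rewrite /lie; mx_expand; mx_abel. Qed.

Lemma lieDr X Y Z : lie X (Y + Z) = lie X Y + lie X Z.
Proof. by rewrite /lie; mx_expand; mx_abel. Qed.

Lemma jacobi X Y Z : lie X (lie Y Z) = lie (lie X Y) Z + lie Y (lie X Z).
Proof. by rewrite /lie; mx_expand; mx_abel. Qed.

Lemma tr_lie X Y : (lie X Y)^T = lie Y^T X^T.
Proof. by rewrite /lie linearB /= !trmx_mul. Qed.

Lemma lie_conj X Y Z : X *m X^T = 1%:M ->
  lie (X *m Y *m X^T) (X *m Z *m X^T) = X *m lie Y Z *m X^T.
Proof.
move=> /mulmx1C XX; rewrite /lie mulmxBr mulmxBl !mulmxA.
by rewrite -[X *m Y *m X^T *m X]mulmxA -[X *m Z *m X^T *m X]mulmxA XX !mulmx1.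
Qed.

End Bracket.

(** A resolution of the identity by mutually orthogonal symmetric projections, such as the
    eigenprojections of a symmetric matrix. *)
Definition spectral_family (R : comNzRingType) (n s : nat)
    (E : 'I_s -> 'M[R]_n) : Prop :=
  [/\ forall i, (E i)^T = E i,
      forall i j, E i *m E j = (i == j)%:R *: E i &
      \sum_i E i = 1%:M].

(** The block diagonal part of [Z]; for a spectral family, it is the projection onto the matrices
    that commute with every [E i]. *)
Definition pinch (R : comNzRingType) (n s : nat)
  (E : 'I_s -> 'M[R]_n) (Z : 'M[R]_n) : 'M[R]_n := \sum_i E i *m Z *m E i.

Section Spectral.
Variables (R : fieldType) (n s : nat) (E : 'I_s -> 'M[R]_n) (a : 'I_s -> R).
Hypotheses (famE : spectral_family E) (ainj : injective a).
Implicit Types Y Z : 'M[R]_n.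
Let A := \sum_i a i *: E i.

Let tE i : (E i)^T = E i. Proof. by case: famE. Qed.
Let mE i j : E i *m E j = (i == j)%:R *: E i. Proof. by case: famE. Qed.
Let sE : \sum_i E i = 1%:M. Proof. by case: famE. Qed.

Lemma spectral_mull i : E i *m A = a i *: E i.
Proof.
rewrite /A mulmx_sumr (bigD1 i) //= -scalemxAr mE eqxx scale1r big1 ?addr0 //.
by move=> j ji; rewrite -scalemxAr mE eq_sym (negbTE ji) scale0r scaler0.
Qed.

Lemma spectral_mulr i : A *m E i = a i *: E i.
Proof.
rewrite /A mulmx_suml (bigD1 i) //= -scalemxAl mE eqxx scale1r big1 ?addr0 //.
by move=> j ji; rewrite -scalemxAl mE (negbTE ji) scale0r scaler0.
Qed.

Lemma tr_spectral : A^T = A.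
Proof. by rewrite linear_sum /=; apply: eq_bigr => i _; rewrite linearZ /= tE. Qed.

(** Since [E k (A Y - Y A) E l = (a k - a l) E k Y E l] and the [a k] are distinct, commuting with
    [A] kills every block of [Y] with [k != l]. *)
Lemma spectral_comm Y :
  A *m Y = Y *m A <-> forall i, E i *m Y = Y *m E i.
Proof.
split=> [AY i|EY]; last first.
  rewrite mulmx_suml mulmx_sumr; apply: eq_bigr => i _.
  by rewrite -scalemxAl EY scalemxAr.
have off k l : k != l -> E k *m Y *m E l = 0.
  move=> kl; apply/eqP; have : (a l - a k) *: (E k *m Y *m E l) = 0.
    have : E k *m (A *m Y) *m E l = E k *m (Y *m A) *m E l by rewrite AY.
    rewrite !mulmxA spectral_mull -[_ *m A *m _]mulmxA spectral_mulr.
    by rewrite -!scalemxAl -scalemxAr scalerBl => ->; rewrite subrr.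
  by move/eqP; rewrite scaler_eq0 subr_eq0 (inj_eq ainj) eq_sym (negbTE kl).
rewrite -[LHS]mulmx1 -[RHS]mul1mx -sE mulmx_sumr mulmx_suml.
rewrite (bigD1 i) //= [RHS](bigD1 i) //= !big1 ?addr0 ?mulmxA //.
  by move=> j ji; rewrite mulmxA off.
by move=> j ji; rewrite off // eq_sym.
Qed.

Lemma pinchD Y Z : pinch E (Y + Z) = pinch E Y + pinch E Z.
Proof. by rewrite -big_split; apply: eq_bigr => i _; rewrite mulmxDr mulmxDl. Qed.

Lemma pinchB Y Z : pinch E (Y - Z) = pinch E Y - pinch E Z.
Proof. by rewrite -sumrB; apply: eq_bigr => i _; rewrite mulmxBr mulmxBl. Qed.

Lemma pinchZ c Z : pinch E (c *: Z) = c *: pinch E Z.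
Proof.
by rewrite scaler_sumr; apply: eq_bigr => i _; rewrite -scalemxAr -scalemxAl.
Qed.

Lemma tr_pinch Z : (pinch E Z)^T = pinch E Z^T.
Proof.
rewrite linear_sum; apply: eq_bigr => i _ /=.
by rewrite !trmx_mul tE mulmxA.
Qed.

Lemma pinch_comm Z i : E i *m pinch E Z = pinch E Z *m E i.
Proof.
rewrite mulmx_suml mulmx_sumr; apply: eq_bigr => j _.
rewrite !mulmxA mE -!mulmxA mE eq_sym.
by case: eqP => [->|_]; rewrite ?scale1r // !scale0r mul0mx !mulmx0.
Qed.

Lemma pinch_id Z : (forall i, E i *m Z = Z *m E i) -> pinch E Z = Z.
Proof.
move=> EZ; rewrite -[RHS]mulmx1 -sE mulmx_sumr; apply: eq_bigr => i _.
by rewrite EZ -mulmxA mE eqxx scale1r.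
Qed.

Lemma pinchK Z : pinch E (pinch E Z) = pinch E Z.
Proof. by apply: pinch_id; exact: pinch_comm. Qed.

Lemma pinch_lie Y Z : (forall i, E i *m Y = Y *m E i) ->
  pinch E (lie Y Z) = lie Y (pinch E Z).
Proof.
move=> EY; rewrite /lie pinchB mulmx_sumr mulmx_suml.
by congr (_ - _); apply: eq_bigr => i _; rewrite !mulmxA ?EY // -!mulmxA EY.
Qed.

Lemma pinch_lie_spectral Z : pinch E (lie A Z) = 0.
Proof.
rewrite pinch_lie; first by apply/lieP/spectral_comm; exact: pinch_comm.
by move=> i; rewrite spectral_mull spectral_mulr.
Qed.

(** Solves [[W, A] = Z] when [Z] has no diagonal blocks: block [(k, l)] of [[W, A]] is [a l - a k]
    times that of [W]. The terms with [k = l] vanish because [0^-1 = 0]. *)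
Definition lie_inv Z : 'M[R]_n :=
  \sum_k \sum_l (a l - a k)^-1 *: (E k *m Z *m E l).

Lemma lie_invK Z : lie (lie_inv Z) A = Z - pinch E Z.
Proof.
have -> : Z - pinch E Z = \sum_k \sum_l (k != l)%:R *: (E k *m Z *m E l).
  have -> : pinch E Z = \sum_k \sum_l (k == l)%:R *: (E k *m Z *m E l).
    apply: eq_bigr => k _; rewrite (bigD1 k) //= eqxx scale1r big1 ?addr0 //.
    by move=> l lk; rewrite eq_sym (negbTE lk) scale0r.
  have {1}-> : Z = \sum_k \sum_l E k *m Z *m E l.
    rewrite -[LHS]mulmx1 -sE -{1}[Z]mul1mx -{1}sE mulmx_suml mulmx_suml.
    by apply: eq_bigr => k _; rewrite mulmx_sumr.
  rewrite -sumrB; apply: eq_bigr => k _; rewrite -sumrB; apply: eq_bigr => l _.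
  by case: (k == l); rewrite !(scale1r, scale0r) ?subrr ?subr0.
rewrite /lie mulmx_suml mulmx_sumr -sumrB; apply: eq_bigr => k _.
rewrite mulmx_suml mulmx_sumr -sumrB; apply: eq_bigr => l _.
rewrite -scalemxAl -scalemxAr -scalerBr -[_ *m A]mulmxA spectral_mull !mulmxA.
rewrite spectral_mulr -scalemxAr -!scalemxAl -scalerBl scalerA.
have [->|kl] := eqVneq k l; first by rewrite subrr mulr0.
by rewrite mulVf // subr_eq0 (inj_eq ainj) eq_sym.
Qed.

(** Transposition exchanges [k] and [l], and the coefficients are antisymmetric in them. *)
Lemma tr_lie_inv Z : Z^T = Z -> (lie_inv Z)^T = - lie_inv Z.
Proof.
move=> Zs; rewrite /lie_inv -sumrN linear_sum.
under eq_bigr do rewrite linear_sum /=.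
rewrite exchange_big; apply: eq_bigr => k _; rewrite -sumrN; apply: eq_bigr => l _.
by rewrite linearZ /= !trmx_mul !tE Zs mulmxA -scaleNr -invrN opprB.
Qed.

(** As [B] and [[Z, B]] commute with the projections of [A], pinching commutes with the bracket by
    [B] and fixes [[Z, B]]; so [[pinch E Z, B] = [Z, B]]. *)
Lemma spectral_lie_split B Z : lie A B = 0 -> lie A (lie Z B) = 0 ->
  lie A (pinch E Z) = 0 /\ lie (Z - pinch E Z) B = 0.
Proof.
move=> /lieP/spectral_comm EB /lieP/spectral_comm EZB.
split; first by apply/lieP/spectral_comm; exact: pinch_comm.
have EBZ i : E i *m lie B Z = lie B Z *m E i by rewrite lieC mulmxN mulNmx EZB.
by rewrite lieBl [lie (pinch _ _) _]lieC -pinch_lie // pinch_id // -lieC subrr.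
Qed.

End Spectral.

Lemma spectral_family_conj (R : comNzRingType) n s (E : 'I_s -> 'M[R]_n)
    (X : 'M[R]_n) :
  spectral_family E -> X *m X^T = 1%:M ->
  spectral_family (fun i => X *m E i *m X^T).
Proof.
move=> [tE mE sE] XX; split=> [i|i j|].
- by rewrite !trmx_mul trmxK tE mulmxA.
- have XX' := mulmx1C XX.
  rewrite !mulmxA -[X *m E i *m X^T *m X]mulmxA XX' mulmx1 -[X *m E i *m E j]mulmxA.
  by rewrite mE -scalemxAr -scalemxAl.
- by rewrite -mulmx_suml -mulmx_sumr sE mulmx1.
Qed.

Lemma spectral_conj (R : comNzRingType) n s (E : 'I_s -> 'M[R]_n) a (X : 'M[R]_n) :
  X *m (\sum_i a i *: E i) *m X^T = \sum_i a i *: (X *m E i *m X^T).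
Proof.
rewrite mulmx_sumr mulmx_suml; apply: eq_bigr => i _.
by rewrite -scalemxAr -scalemxAl.
Qed.

(** * Block diagonal matrices and their spectral projections *)

Section BlockDiag.
Variables (R : realType) (n s : nat) (p : 'I_s -> nat) (E : (\sum_i p i)%N = n).

Lemma block_diag_mul (W W' : forall i, 'M[R]_(p i)) :
  block_diag E W *m block_diag E W' = block_diag E (fun i => W i *m W' i).
Proof.
case: n / E; rewrite /block_diag !castmx_id {2}/mxdiag mul_mxdiag_mxblock.
apply/eq_mxblock => i j; case: eqVneq => [ij|ij]; last by rewrite mulmx0.
by case: _ / ij; rewrite !conform_mx_id.
Qed.

Lemma tr_block_diag (W : forall i, 'M[R]_(p i)) :
  (block_diag E W)^T = block_diag E (fun i => (W i)^T).
Proof. by case: n / E; rewrite /block_diag !castmx_id tr_mxdiag. Qed.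

Lemma block_diag_inj (W W' : forall i, 'M[R]_(p i)) :
  block_diag E W = block_diag E W' -> forall i, W i = W' i.
Proof. by case: n / E; rewrite /block_diag !castmx_id => /eq_mxdiagP. Qed.

(** Block [(i, j)] of the two products is [a i], respectively [a j], times that of [Y], so only
    diagonal blocks survive. *)
Lemma block_diag_comm (a : 'I_s -> R) (Y : 'M[R]_n) : injective a ->
  block_diag E (fun i => (a i)%:M) *m Y = Y *m block_diag E (fun i => (a i)%:M) ->
  exists W, Y = block_diag E W.
Proof.
move=> ainj; move: Y; case: n / E => Y; rewrite /block_diag castmx_id => AY.
exists (fun i => submxblock Y i i); rewrite castmx_id -{1}[Y]submxblockK.
apply/eq_mxblock => i j; case: eqVneq => [ij|ij].
  by case: _ / ij; rewrite conform_mx_id.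
move: AY; rewrite -[Y]submxblockK mul_mxblock_mxdiag mul_mxdiag_mxblock.
move=> /eq_mxblockP/(_ i j)/eqP; rewrite mul_scalar_mx mul_mx_scalar submxblockK.
rewrite -subr_eq0 -scalerBl scaler_eq0 subr_eq0 (inj_eq ainj) (negbTE ij).
by move=> /eqP.
Qed.

Lemma block_diag_symP (a : 'I_s -> R) (Y : 'M[R]_n) : injective a -> Y^T = Y ->
  lie (block_diag E (fun i => (a i)%:M)) Y = 0 <->
  exists2 W : forall i, 'M[R]_(p i), forall i, (W i)^T = W i & Y = block_diag E W.
Proof.
move=> ainj Ys; split=> [/lieP/(block_diag_comm ainj)[W eW]|[W _ ->]].
  exists W => //; apply: block_diag_inj; by rewrite -tr_block_diag -eW.
apply/lieP; rewrite !block_diag_mul; congr block_diag.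
by apply/functional_extensionality_dep => i; rewrite mul_scalar_mx mul_mx_scalar.
Qed.

Lemma block_diag_sum (I : finType) (W : I -> forall i, 'M[R]_(p i)) :
  \sum_k block_diag E (W k) = block_diag E (fun i => \sum_k W k i).
Proof.
case: n / E; rewrite /block_diag castmx_id mxdiag_sum.
by apply: eq_bigr => k _; rewrite castmx_id.
Qed.

Lemma block_diagZ c (W : forall i, 'M[R]_(p i)) :
  c *: block_diag E W = block_diag E (fun i => c *: W i).
Proof.
case: n / E; rewrite /block_diag !castmx_id -mul_scalar_mx -mxdiagZ.
rewrite {2}/mxdiag mul_mxdiag_mxblock; apply/eq_mxblock => i j.
case: eqVneq => [ij|ij]; last by rewrite mulmx0.
by case: _ / ij; rewrite !conform_mx_id mul_scalar_mx.
Qed.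

Lemma block_diag1 : block_diag E (fun i => 1%:M) = 1%:M :> 'M[R]_n.
Proof. by case: n / E; rewrite /block_diag castmx_id mxdiagZ. Qed.

Lemma block_diag_spectral (a : 'I_s -> R) : exists2 P : 'I_s -> 'M[R]_n,
  spectral_family P & block_diag E (fun i => (a i)%:M) = \sum_i a i *: P i.
Proof.
(* Projection [k] is the identity on block [k] and zero on the others. *)
exists (fun k => block_diag E (fun i => (k == i)%:R%:M)); first split.
- move=> k; rewrite tr_block_diag; congr block_diag.
  by apply/functional_extensionality_dep => i; rewrite tr_scalar_mx.
- move=> k l; rewrite block_diag_mul block_diagZ; congr block_diag.
  apply/functional_extensionality_dep => i; rewrite -scalar_mxM scale_scalar_mx.
  by congr (_%:M); case: eqVneq => [->|kl]; rewrite ?mul1r ?mul0r; case: eqVneq;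
    rewrite ?mul1r ?mul0r // => <-; rewrite eq_sym (negbTE kl).
- rewrite block_diag_sum -[RHS]block_diag1; congr block_diag.
  apply/functional_extensionality_dep => i.
  by rewrite (bigD1 i) //= eqxx big1 ?addr0 // => k ki; rewrite (negbTE ki) raddf0.
- under eq_bigr do rewrite block_diagZ.
  rewrite block_diag_sum; congr block_diag.
  apply/functional_extensionality_dep => i.
  rewrite (bigD1 i) //= eqxx scalemx1 big1 ?addr0 // => k ki.
  by rewrite (negbTE ki) scale_scalar_mx mulr0 raddf0.
Qed.

End BlockDiag.

(** * The critical locus *)

Lemma is_derive_lin (R : realType) (V W : normedModType R) (l : {linear V -> W})
    (x v : V) : continuous l -> is_derive x v l (l v).
Proof.
move=> cl; apply: is_derive_eq (differentiable_is_derive v _) _.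
  exact: linear_differentiable.
by rewrite diff_lin.
Qed.

Lemma is_derive_scalemx (R : realType) (V : normedModType R) m n (k : V -> R)
    (W : 'M[R]_(m, n)) dk (x v : V) :
  is_derive x v k dk -> is_derive x v (fun y => k y *: W) (dk *: W).
Proof.
move=> dkx; apply/is_derive_mxP => i j; rewrite mxE.
rewrite (_ : (fun y => _) = fun y => k y * W i j); last first.
  by apply/funext=> y; rewrite mxE.
apply: is_derive_eq (is_deriveM dkx (is_derive_cst (W i j) x v)) _.
by rewrite scaler0 add0r -[_ *: _]/(_ * _) mulrC.
Qed.

Lemma mxtraceB (R : pzRingType) n (M N : 'M[R]_n) : \tr (M - N) = \tr M - \tr N.
Proof. exact: raddfB. Qed.

Section Orthogonal.
Variables (R : realType) (n : nat).
Implicit Types X M W : 'M[R]_n.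

Lemma skew_scale c W : W^T = - W -> (c *: W)^T = - (c *: W).
Proof. by move=> Ws; rewrite linearZ /= Ws scalerN. Qed.

Lemma half_mulr2n W : (2^-1 *: W) *+ 2 = W.
Proof. by rewrite -scaler_nat scalerA mulfV ?pnatr_eq0 ?scale1r. Qed.

Lemma orthogonal_mul X Y :
  orthogonal_group X -> orthogonal_group Y -> @orthogonal_group R n (X *m Y).
Proof.
rewrite /orthogonal_group /= => XX YY.
by rewrite trmx_mul mulmxA -(mulmxA X) YY mulmx1.
Qed.

(** Right translation: [W = M X^T] turns tangent vectors at [X] into skew matrices, the parameter of
    all later computations. *)
Lemma tangent_OP X M : orthogonal_group X ->
  tangent_O X M <-> exists2 W, W^T = - W & M = W *m X.
Proof.
rewrite /orthogonal_group /tangent_O /= => XX; split=> [XM|[W Ws ->]].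
  exists (M *m X^T); last by rewrite -mulmxA (mulmx1C XX) mulmx1.
  by rewrite trmx_mul trmxK; apply/eqP; rewrite -addr_eq0 addrC XM.
by rewrite trmx_mul Ws mulmxN mulmxN mulmxA XX mul1mx -mulmxA XX mulmx1 subrr.
Qed.

Lemma mxtrace_norm0 X : \tr (X *m X^T) = 0 -> X = 0.
Proof.
move=> /eqP; rewrite /mxtrace psumr_eq0; last first.
  by move=> i _; rewrite mxE sumr_ge0 // => j _; rewrite mxE -expr2 sqr_ge0.
move=> /allP X0; apply/row_matrixP => i; rewrite row0; apply: row_norm0.
have := X0 i; rewrite mem_index_enum => /(_ isT) /eqP Xi.
apply/matrixP => k l; rewrite !ord1 [RHS]mxE -[RHS]Xi !mxE.
by apply: eq_bigr => j _; rewrite !mxE.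
Qed.

(** The trace form is definite on skew matrices: testing against [X] itself gives
    [- tr (X X^T) = 0]. *)
Lemma skew_trace0 X : X^T = - X ->
  (forall W, W^T = - W -> \tr (W *m X) = 0) -> X = 0.
Proof.
move=> Xs WX; apply: mxtrace_norm0; rewrite Xs mulmxN linearN /= WX //.
exact: oppr0.
Qed.

Lemma tangent_space_O (S : set 'M[R]_n) X M :
  S `<=` @orthogonal_group R n -> tangent_space S X M -> tangent_O X M.
Proof.
move=> SO [U [c [oU U0 sc cS [c0 dc0]]]].
have dc : is_derive (0 : R) 1 c M.
  rewrite -dc0 derive1E; apply/derivableP/diff_derivable.
  exact: smooth_on_differentiable sc U0.
have /is_derive_uniq/(_ (is_derive_cst 1%:M (0 : R) 1)) :=
  is_derive_mulmx dc (is_derive_trmx dc).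
rewrite c0; apply; near=> t; apply: SO; apply: cS; near: t.
exact: open_nbhs_nbhs.
Unshelve. all: by end_near. Qed.

End Orthogonal.

(** * First variations of [X B X^T] and [X^T A X] *)

Section Velocity.
Variables (R : comNzRingType) (n : nat) (A B X W : 'M[R]_n).
Hypotheses (XX : X *m X^T = 1%:M) (As : A^T = A) (Bs : B^T = B) (Ws : W^T = - W).

Lemma velocity :
  W *m X *m B *m X^T + X *m B *m (W *m X)^T = lie W (X *m B *m X^T).
Proof. by rewrite /lie trmx_mul Ws !mulmxN !mulmxA. Qed.

Lemma covelocity :
  X^T *m A *m (W *m X) + (W *m X)^T *m A *m X = X^T *m lie A W *m X.
Proof. by rewrite /lie trmx_mul Ws !(mulmxN, mulNmx, mulmxBr, mulmxBl) !mulmxA. Qed.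

Lemma tr_conj : (X *m B *m X^T)^T = X *m B *m X^T.
Proof. by rewrite !trmx_mul trmxK Bs mulmxA. Qed.

Lemma tr_velocity : (lie W (X *m B *m X^T))^T = lie W (X *m B *m X^T).
Proof. by rewrite tr_lie tr_conj Ws /lie mulmxN mulNmx opprK addrC. Qed.

Lemma tr_covelocity : (X^T *m lie A W *m X)^T = X^T *m lie A W *m X.
Proof.
rewrite !trmx_mul trmxK tr_lie As Ws mulmxA; congr (_ *m _ *m _).
by rewrite /lie mulmxN mulNmx opprK addrC.
Qed.

(** With [C = X B X^T] and [[A, C] = 0], the Jacobi identity gives [[A, [W, C]] = [[A, W], C]];
    conjugation by [X] then turns [C] into [B] and [[A, W]] into [X^T [A, W] X]. *)
Lemma lie_velocity_covelocity : lie A (X *m B *m X^T) = 0 ->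
  lie A (lie W (X *m B *m X^T)) = 0 <-> lie B (X^T *m lie A W *m X) = 0.
Proof.
move=> AB; rewrite jacobi AB [lie W 0]/lie mulmx0 mul0mx subr0 addr0.
have -> : lie A W = X *m (X^T *m lie A W *m X) *m X^T.
  by rewrite !mulmxA XX mul1mx -mulmxA XX mulmx1.
move: (X^T *m _ *m X) => Q.
rewrite lie_conj // -[X in X *m _ *m X^T]/X; have XX' := mulmx1C XX.
have -> : X^T *m (X *m Q *m X^T) *m X = Q.
  by rewrite !mulmxA XX' mul1mx -mulmxA XX' mulmx1.
split=> [e|e]; last by rewrite lieC e oppr0 mulmx0 mul0mx.
rewrite lieC -[lie Q B]mul1mx -XX' -[X in - X]mulmx1 -XX' -!mulmxA.
by rewrite [X in _ *m X](_ : _ = 0) ?mulmx0 ?oppr0 // !mulmxA e mul0mx.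
Qed.

Lemma symm_mulP (P : 'M[R]_n) : P^T = P -> (A *m P)^T = A *m P <-> lie A P = 0.
Proof. by move=> Ps; rewrite trmx_mul Ps As lieP; split=> ->. Qed.

End Velocity.

Section CriticalLocus.
Variables (R : realType) (n : nat) (A B : 'M[R]_n).
Hypotheses (As : A^T = A) (Bs : B^T = B).
Implicit Types X M W : 'M[R]_n.
Let f := trace_fun A B.

(** The derivative is [tr (A [W, C])] with [C = X B X^T], and cyclicity isolates [W]: up to sign,
    [[A, C]] is the gradient for the trace pairing. *)
Lemma diff_trace_fun_skew X W : W^T = - W ->
  'd f X (W *m X) = - \tr (W *m lie A (X *m B *m X^T)) :> R.
Proof.
move=> Ws; rewrite diff_trace_fun -!mulmxA -mulmxDr !mulmxA velocity //.
move: (X *m B *m X^T) => C; rewrite /lie !mulmxBr !mxtraceB opprB !mulmxA.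
by rewrite -[A *m W *m C]mulmxA mxtrace_mulC -[X in _ - X]mxtrace_mulC !mulmxA.
Qed.

Lemma tr_lie_conj X : (lie A (X *m B *m X^T))^T = - lie A (X *m B *m X^T).
Proof. by rewrite tr_lie tr_conj // As lieC. Qed.

Lemma critical_locusP X : critical_locus f X <->
  orthogonal_group X /\ lie A (X *m B *m X^T) = 0.
Proof.
split=> -[XX fX]; split=> //.
  apply: skew_trace0; first exact: tr_lie_conj.
  move=> W Ws; apply/eqP; rewrite -oppr_eq0 -diff_trace_fun_skew // fX //.
  by apply/(tangent_OP _ XX); exists W.
move=> M /(tangent_OP _ XX)[W Ws ->].
by rewrite diff_trace_fun_skew // fX mulmx0 mxtrace0 oppr0.
Qed.

(** Along a curve [c] of critical points [A] commutes with [c B c^T]; this relation is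
    differentiated at 0. *)
Lemma critical_velocity X W : W^T = - W ->
  tangent_space (critical_locus f) X (W *m X) -> orthogonal_group X ->
  lie A (lie W (X *m B *m X^T)) = 0.
Proof.
move=> Ws [U [c [oU U0 sc cF [c0 dc0]]]] XX.
have dc : is_derive (0 : R) 1 c (W *m X).
  rewrite -dc0 derive1E; apply/derivableP/diff_derivable.
  exact: smooth_on_differentiable sc U0.
have dB := is_derive_mulmx (is_derive_mulmxr B dc) (is_derive_trmx dc).
rewrite c0 velocity // in dB.
apply/lieP; apply: is_derive_uniq (is_derive_mulmxl A dB) (is_derive_mulmxr A dB).
near=> t; apply/lieP; have /critical_locusP[] // : critical_locus f (c t).
apply: cF; near: t; exact: open_nbhs_nbhs.
Unshelve. all: by end_near. Qed.

(** The factor [2^-1] compensates for the derivative of the Cayley transform at 0, which is twice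
    the identity. *)
Lemma is_derive_cayley_scale W : W^T = - W ->
  is_derive (0 : R) 1 (fun t => cayley (t *: (2^-1 *: W))) W.
Proof.
move=> Ws; have Ws2 := skew_scale 2^-1 Ws.
apply: is_derive_eq (half_mulr2n W); apply: is_derive_cayley.
- by move=> t; exact: skew_scale.
- by apply: smooth_scalel; exact: smooth_id.
- by rewrite scale0r.
- apply: is_derive_eq (is_derive_scalemx _ (is_derive_id (0 : R) 1)) _.
  by rewrite scale1r.
Qed.

Lemma smooth_cayley_scale W : W^T = - W ->
  smooth_on setT (fun t : R => cayley (t *: W)).
Proof.
move=> Ws; apply: smooth_cayley; first by move=> t; exact: skew_scale.
by apply: smooth_scalel; exact: smooth_id.
Qed.

Lemma velocity_critical s (E : 'I_s -> 'M[R]_n) a X W : spectral_family E ->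
  injective a -> A = \sum_i a i *: E i -> W^T = - W -> critical_locus f X ->
  lie A (lie W (X *m B *m X^T)) = 0 -> tangent_space (critical_locus f) X (W *m X).
Proof.
move=> famE ainj eA Ws /critical_locusP[XX AX] AWX.
set C := X *m B *m X^T in AX AWX.
have [AW1 W2C] : lie A (pinch E W) = 0 /\ lie (W - pinch E W) C = 0.
  by rewrite eA; apply: spectral_lie_split; rewrite -?eA.
set W1 := pinch E W in AW1 W2C; set W2 := W - W1 in W2C.
have W1s : W1^T = - W1 by rewrite tr_pinch // Ws -scaleN1r pinchZ scaleN1r.
have W2s : W2^T = - W2 by rewrite linearB /= W1s Ws opprD.
pose c1 t := cayley (t *: (2^-1 *: W1)); pose c2 t := cayley (t *: (2^-1 *: W2)).
have c1O t : orthogonal_group (c1 t).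
  by apply: cayley_orthogonal; do 2!apply: skew_scale.
have c2O t : orthogonal_group (c2 t).
  by apply: cayley_orthogonal; do 2!apply: skew_scale.
exists setT, (fun t => c1 t *m c2 t *m X); split => //.
- exact: openT.
- apply: smooth_mulmx; last exact: smooth_cst.
  by apply: smooth_mulmx; apply: smooth_cayley_scale; exact: skew_scale.
- move=> t _; apply/critical_locusP; split.
    by do 2?apply: orthogonal_mul.
  (* [c2 t] commutes with [C] and drops out of the conjugation; the rest commutes with [A] because
     [c1 t] and [C] do. *)
  have -> : c1 t *m c2 t *m X *m B *m (c1 t *m c2 t *m X)^T =
      c1 t *m C *m (c1 t)^T.
    transitivity (c1 t *m (c2 t *m C *m (c2 t)^T) *m (c1 t)^T).
      by rewrite /C !trmx_mul !mulmxA.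
    have -> : c2 t *m C = C *m c2 t.
      by apply: cayley_comm; rewrite -!scalemxAl -!scalemxAr; move/lieP: W2C => ->.
    by rewrite -[C *m _ *m _]mulmxA (c2O t) mulmx1.
  have c1A : c1 t *m A = A *m c1 t.
    by apply: cayley_comm; rewrite -!scalemxAl -!scalemxAr; move/lieP: AW1 => ->.
  have c1A' : (c1 t)^T *m A = A *m (c1 t)^T.
    by rewrite -{1}As -trmx_mul -c1A trmx_mul As.
  apply/lieP; move/lieP: AX => AX; move: (c1 t) (C) c1A c1A' AX => Q D QA QA' AD.
  by rewrite !mulmxA -QA -[Q *m A *m D]mulmxA AD -[RHS]mulmxA QA' !mulmxA.
- split; first by rewrite /c1 /c2 !scale0r cayley0 !mul1mx.
  rewrite derive1E; apply: derive_val.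
  have d1 := is_derive_cayley_scale W1s; have d2 := is_derive_cayley_scale W2s.
  apply: is_derive_eq (is_derive_mulmxr X (is_derive_mulmx d1 d2)) _.
  by rewrite !scale0r cayley0 mulmx1 mul1mx addrC subrK.
Qed.

End CriticalLocus.

(** * The Hessian *)

Lemma mxtraceN (R : pzRingType) n (M : 'M[R]_n) : \tr (- M) = - \tr M.
Proof. exact: raddfN. Qed.

Lemma smooth_fst (R : realType) (V W : normedModType R) :
  smooth_on setT (fst : V * W -> V) /\
  forall p v : V * W, is_derive p v fst v.1.
Proof.
have lin : linear (fst : V * W -> V) by [].
pose l : {linear (V * W)%type -> V} :=
  HB.pack (fst : (V * W)%type -> V) (GRing.isLinear.Build _ _ _ _ _ lin).
have cl : continuous l by move=> x; exact: cvg_fst.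
by split=> [|p v]; [exact: (smooth_lin cl)|exact: (is_derive_lin p v cl)].
Qed.

Lemma smooth_snd (R : realType) (V W : normedModType R) :
  smooth_on setT (snd : V * W -> W) /\
  forall p v : V * W, is_derive p v snd v.2.
Proof.
have lin : linear (snd : V * W -> W) by [].
pose l : {linear (V * W)%type -> W} :=
  HB.pack (snd : (V * W)%type -> W) (GRing.isLinear.Build _ _ _ _ _ lin).
have cl : continuous l by move=> x; exact: cvg_snd.
by split=> [|p v]; [exact: (smooth_lin cl)|exact: (is_derive_lin p v cl)].
Qed.

Section Hessian.
Variables (R : realType) (n : nat) (A B : 'M[R]_n).
Hypotheses (As : A^T = A) (Bs : B^T = B).
Implicit Types X M W : 'M[R]_n.
Let f := trace_fun A B.

(** [Q] stands for the mixed second derivative of a surface, translated to the identity. As [A] and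
    [C] commute, the trace sees only [Q + Q^T], which orthogonality determines; this is why the
    Hessian does not depend on the surface. *)
Lemma tr_sym_skew (C W V Q : 'M[R]_n) : C^T = C -> W^T = - W -> V^T = - V ->
  lie A C = 0 -> Q + Q^T = V *m W + W *m V ->
  \tr (A *m Q *m C + A *m V *m C *m W^T + A *m W *m C *m V^T + A *m C *m Q^T) =
  \tr (V *m lie (lie W C) A).
Proof.
move=> Cs Ws Vs /lieP AC QQ.
have trQ : \tr (A *m Q *m C) + \tr (A *m C *m Q^T) =
    \tr (A *m C *m V *m W) + \tr (A *m C *m W *m V).
  rewrite mxtrace_mulC mulmxA -AC -[LHS]mxtraceD -mulmxDr QQ mulmxDr mxtraceD.
  by rewrite !mulmxA.
have e1 : \tr (V *m W *m C *m A) = \tr (A *m C *m V *m W).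
  by rewrite -mulmxA -AC mxtrace_mulC !mulmxA.
have e2 : \tr (V *m C *m W *m A) = \tr (A *m V *m C *m W).
  by rewrite mxtrace_mulC !mulmxA.
have e3 : \tr (V *m A *m W *m C) = \tr (A *m W *m C *m V).
  by rewrite -!mulmxA mxtrace_mulC !mulmxA.
have e4 : \tr (V *m A *m C *m W) = \tr (A *m C *m W *m V).
  by rewrite -!mulmxA mxtrace_mulC !mulmxA.
rewrite /lie !(mulmxBl, mulmxBr) !mulmxA !mxtraceB e1 e2 e3 e4 !mxtraceD Ws Vs.
rewrite !mulmxN !mxtraceN; move: trQ; set t1 := \tr (A *m Q *m C).
by move=> /eqP; rewrite -subr_eq => /eqP <-; ring.
Qed.

Lemma surface_hessian X W V (c : R * R -> 'M[R]_n) : critical_locus f X ->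
  W^T = - W -> V^T = - V -> adapted_surface X (W *m X) (V *m X) c ->
  'D_(1, 0) (fun p => 'D_(0, 1) (f \o c) p : R) (0, 0) =
  \tr (V *m lie (lie W (X *m B *m X^T)) A).
Proof.
pose o : R * R := (0, 0); pose u : R * R := (1, 0); pose v : R * R := (0, 1).
rewrite -/o -/u -/v => /(critical_locusP As Bs)[XX AC] Ws Vs.
move=> [[U [oU U0 sc cO]] [c0 cu cv]].
have dc p w : U p -> is_derive p w c ('d c p w).
  by move=> Up; apply/differentiable_is_derive/(smooth_on_differentiable sc).
pose d p : 'M[R]_n := 'd c p v.
have sd : smooth_on U d by exact: smooth_on_diff.
have d0 : d o = V *m X by rewrite -cv; have [_ ->] := dc _ v U0.
have du : is_derive o u c (W *m X).
  by apply: is_derive_eq (dc _ _ U0) _; rewrite -cu; have [_ ->] := dc _ u U0.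
pose Q : 'M[R]_n := 'd d o u.
have dd : is_derive o u d Q.
  by apply/differentiable_is_derive/(smooth_on_differentiable sd).
have nU : \forall p \near o, U p by exact: open_nbhs_nbhs.
(* Orthogonality is differentiated along [v] on a whole neighbourhood, so that it can be
   differentiated again along [u]. *)
have near_eq : \forall p \near o, d p *m (c p)^T + c p *m (d p)^T = 0.
  near=> p; have Up : U p by near: p.
  have /is_derive_uniq := is_derive_mulmx (dc p v Up) (is_derive_trmx (dc p v Up)).
  move=> /(_ _ _ _ (is_derive_cst 1%:M p v)); apply.
  have : \forall q \near p, U q by exact: open_nbhs_nbhs.
  by apply: filterS => q /cO.
have QE : Q *m X^T + X *m Q^T = V *m W + W *m V.
  have h := is_derive_uniq near_eq (is_deriveD
    (is_derive_mulmx dd (is_derive_trmx du))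
    (is_derive_mulmx du (is_derive_trmx dd))) (is_derive_cst 0 _ _).
  move: h; rewrite c0 d0 !trmx_mul Ws Vs.
  rewrite !mulmxN -!mulmxA ![X *m (X^T *m _)]mulmxA XX !mul1mx.
  by move=> /eqP; rewrite [- _ + _]addrC addrACA -opprD subr_eq0 => /eqP.
(* The inner derivative has this closed form near [o], hence the outer one may be computed on the
   formula. *)
have hE : \forall p \near o,
    \tr (A *m d p *m B *m (c p)^T + A *m c p *m B *m (d p)^T)
    = 'D_v (f \o c) p :> R.
  near=> p; have Up : U p by near: p.
  by have [_ ->] := is_derive_trace_fun A B (dc p v Up).
have h := near_eq_is_derive hE (is_derive_mxtrace (is_deriveD
  (is_derive_quad A B dd du) (is_derive_quad A B du dd))).
have [_ ->] := h; rewrite c0 d0.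
rewrite -(tr_sym_skew (tr_conj X Bs) Ws Vs AC (Q := Q *m X^T)); last first.
  by rewrite trmx_mul trmxK.
rewrite !trmx_mul trmxK !mulmxA addrA; have XX' := mulmx1C XX.
by rewrite -!(mulmxA _ X^T X) XX' !mulmx1.
Unshelve. all: by end_near. Qed.

(** Makes the set under [get] in [hessian] nonempty, so that [get] does not return a default value.
    The surface is the Cayley transform of [(u W + v V) / 2], applied to [X]. *)
Lemma adapted_surface_exists X W V : orthogonal_group X ->
  W^T = - W -> V^T = - V ->
  exists c : R * R -> 'M[R]_n, adapted_surface X (W *m X) (V *m X) c.
Proof.
move=> XX Ws Vs; pose K (p : R * R) := p.1 *: (2^-1 *: W) + p.2 *: (2^-1 *: V).
have [sfst dfst] := smooth_fst R R; have [ssnd dsnd] := smooth_snd R R.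
have Ks p : (K p)^T = - K p.
  by rewrite linearD /= !skew_scale ?opprD //; exact: skew_scale.
have sK : smooth_on setT K.
  by apply: smooth_add; apply: smooth_scalel.
have dK v : is_derive (0, 0) v (fun p => cayley (K p) *m X)
    ((v.1 *: W + v.2 *: V) *m X).
  apply: is_derive_mulmxr.
  have d1 := dfst (0, 0) v; have d2 := dsnd (0, 0) v.
  have dK := is_deriveD (is_derive_scalemx (2^-1 *: W) d1)
    (is_derive_scalemx (2^-1 *: V) d2).
  apply: is_derive_eq (is_derive_cayley Ks sK _ dK) _.
    by rewrite /K !scale0r addr0.
  by rewrite mulrnDl (scalerMnr v.1) (scalerMnr v.2) !half_mulr2n.
exists (fun p => cayley (K p) *m X); split.
  exists setT; split => //; first exact: openT.
    by apply: smooth_mulmx; [exact: smooth_cayley|exact: smooth_cst].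
  by move=> p _; apply: orthogonal_mul => //; exact: cayley_orthogonal.
split; first by rewrite /K !scale0r addr0 cayley0 mul1mx.
- by have [_ ->] := dK (1, 0); rewrite scale1r scale0r addr0.
- by have [_ ->] := dK (0, 1); rewrite scale1r scale0r add0r.
Qed.

Lemma hessianE X W V : critical_locus f X -> W^T = - W -> V^T = - V ->
  hessian f X (W *m X) (V *m X) = \tr (V *m lie (lie W (X *m B *m X^T)) A).
Proof.
move=> fX Ws Vs; have /(critical_locusP As Bs)[XX _] := fX.
rewrite /hessian; set S := (X in get X).
have [c cX] := adapted_surface_exists XX Ws Vs.
have /getPex [c' c'X ->] : exists h, S h.
  by exists ('D_(1, 0) (fun p => 'D_(0, 1) (f \o c) p : R) (0, 0)); exists c.
exact: surface_hessian.
Qed.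

(** The Hessian pairs [V] with [[[W, C], A]], where [C = X B X^T]. This matrix is skew, so it
    vanishes when its trace against every skew [V] does. *)
Lemma ker_hessianP X W : critical_locus f X -> W^T = - W ->
  ker_hessian f X (W *m X) <-> lie A (lie W (X *m B *m X^T)) = 0.
Proof.
move=> fX Ws; have /(critical_locusP As Bs)[XX _] := fX.
split=> [[_ kW]|AW].
  rewrite lieC; apply/eqP; rewrite oppr_eq0; apply/eqP; apply: skew_trace0.
    by rewrite tr_lie As tr_velocity // lieC.
  move=> V Vs; rewrite -hessianE //; apply: kW.
  by apply/(tangent_OP _ XX); exists V.
split; first by apply/(tangent_OP _ XX); exists W.
move=> N /(tangent_OP _ XX)[V Vs ->].
by rewrite hessianE // lieC AW oppr0 mulmx0 mxtrace0.
Qed.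

End Hessian.

(** * Transversality of nearby spectral families *)

Lemma smooth_linear_mx (R : realType) m n (W : normedModType R)
    (l : {linear 'M[R]_(m, n) -> W}) : smooth_on setT l.
Proof.
rewrite (_ : l = (fun M => \sum_i \sum_j M i j *: l (delta_mx i j)) :> (_ -> _)).
  do 2!(apply: smooth_sum => ? _); apply: smooth_scalel.
  by apply: (@smooth_coord _ _ _ _ idfun); exact: smooth_id.
apply/funext=> M; rewrite {1}[M]matrix_sum_delta linear_sum.
by apply: eq_bigr => i _; rewrite linear_sum; apply: eq_bigr => j _; rewrite linearZ.
Qed.

Lemma is_derive_linear_mx (R : realType) (V : normedModType R) m n p q
    (l : {linear 'M[R]_(m, n) -> 'M[R]_(p, q)}) (M : V -> 'M[R]_(m, n)) dM x v :
  is_derive x v M dM -> is_derive x v (l \o M) (l dM).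
Proof.
move=> /is_derive_mxP dMx.
have lE N : l N = \sum_i \sum_j N i j *: l (delta_mx i j).
  rewrite {1}[N]matrix_sum_delta linear_sum; apply: eq_bigr => i _.
  by rewrite linear_sum; apply: eq_bigr => j _; rewrite linearZ.
rewrite lE (_ : l \o M = fun y => \sum_i \sum_j M y i j *: l (delta_mx i j)).
  by do 2!(apply: is_derive_bigsum => ? _); exact: is_derive_scalemx.
by apply/funext=> y /=; rewrite lE.
Qed.

Section SmoothMx.
Variables (R : realType) (V : normedModType R).

Lemma smooth_opp (W : normedModType R) (f : V -> W) :
  smooth_on setT f -> smooth_on setT (fun x => - f x).
Proof.
move=> sf; apply: (smooth_lin_comp (l := -%R : {linear W -> W})) => //.
exact: opp_continuous.
Qed.

Lemma smooth_lin_mx m n p q (f : V -> 'M[R]_(m, n) -> 'M[R]_(p, q)) :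
  (forall Z, smooth_on setT (fun x => f x Z)) ->
  smooth_on setT (fun x => lin_mx (f x)).
Proof.
move=> sf; apply: smooth_mx => i j; case/mxvec_indexP: j => k l.
rewrite (_ : (fun x => _) = fun x => f x (vec_mx (delta_mx 0 i)) k l).
  exact: smooth_coord.
by apply/funext=> x; rewrite !mxE /= mxvecE.
Qed.
End SmoothMx.

Section OffDiagonal.
Variables (R : realType) (n t : nat).
Implicit Types (P Q : 'I_t -> 'M[R]_n) (A Z : 'M[R]_n).

Definition offdiag P Z : 'M[R]_n := Z - pinch P Z.

(* Kato's intertwiner between the pinchings of two nearby spectral families; it
   is the identity when P = Q. *)
Definition kato P Q Z : 'M[R]_n := pinch P (pinch Q Z) + offdiag P (offdiag Q Z).

Fact pinch_linear P : linear (pinch P).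
Proof. by move=> c Y Z; rewrite pinchD pinchZ. Qed.
HB.instance Definition _ P := GRing.isLinear.Build R 'M[R]_n 'M[R]_n _ (pinch P)
  (pinch_linear P).

Fact offdiag_linear P : linear (offdiag P).
Proof.
move=> c Y Z; rewrite /offdiag pinchD pinchZ opprD addrACA -scalerBr.
reflexivity.
Qed.
HB.instance Definition _ P := GRing.isLinear.Build R 'M[R]_n 'M[R]_n _ (offdiag P)
  (offdiag_linear P).

Fact kato_linear P Q : linear (kato P Q).
Proof. move=> c Y Z; rewrite /kato !linearP /= addrACA -scalerDr; reflexivity. Qed.
HB.instance Definition _ P Q := GRing.isLinear.Build R 'M[R]_n 'M[R]_n _ (kato P Q)
  (kato_linear P Q).

Fact lie_linear A : linear (lie A).
Proof.
move=> c Y Z; rewrite /lie mulmxDr mulmxDl -scalemxAr -scalemxAl opprD addrACA.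
by rewrite scalerBr.
Qed.
HB.instance Definition _ A := GRing.isLinear.Build R 'M[R]_n 'M[R]_n _ (lie A)
  (lie_linear A).

(* At a critical point X, when P is the spectral family of X B X^T, this has the
   same image as W |-> lie A (lie W (X B X^T)) on skew matrices. *)
Definition off_lie A P Z : 'M[R]_n := lie A (offdiag P (Z + Z^T)).

Fact off_lie_linear A P : linear (off_lie A P).
Proof.
move=> c Y Z; rewrite /off_lie [_^T]linearP /= addrACA -scalerDr offdiag_linear.
exact: lie_linear.
Qed.
HB.instance Definition _ A P := GRing.isLinear.Build R 'M[R]_n 'M[R]_n _
  (off_lie A P) (off_lie_linear A P).

Variables (P Q : 'I_t -> 'M[R]_n).
Hypotheses (famP : spectral_family P) (famQ : spectral_family Q).

Lemma offdiag_pinch Z : offdiag P (pinch P Z) = 0.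
Proof. by rewrite /offdiag pinchK // subrr. Qed.

Lemma pinch_offdiag Z : pinch P (offdiag P Z) = 0.
Proof. by rewrite /offdiag pinchB pinchK // subrr. Qed.

Lemma offdiagK Z : offdiag P (offdiag P Z) = offdiag P Z.
Proof. by rewrite {1}/offdiag pinch_offdiag subr0. Qed.

Lemma tr_offdiag Z : (offdiag P Z)^T = offdiag P Z^T.
Proof. by rewrite linearB /= tr_pinch. Qed.

Lemma offdiag_lie A Z : (forall i, P i *m A = A *m P i) ->
  offdiag P (lie A Z) = lie A (offdiag P Z).
Proof. by move=> PA; rewrite /offdiag pinch_lie // lieBr. Qed.

Lemma kato_id Z : kato P P Z = Z.
Proof. by rewrite /kato pinchK // offdiagK addrC subrK. Qed.

End OffDiagonal.

Section Kato.
Variables (R : realType) (n t : nat) (P Q : 'I_t -> 'M[R]_n).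
Hypotheses (famP : spectral_family P) (famQ : spectral_family Q).
Implicit Types (A Z : 'M[R]_n).

Lemma tr_kato Z : (kato P Q Z)^T = kato P Q Z^T.
Proof. rewrite /kato linearD /= (tr_pinch famP) (tr_pinch famQ).
by rewrite (tr_offdiag famP) (tr_offdiag famQ). Qed.

Lemma offdiag_kato Z : offdiag P (kato P Q Z) = offdiag P (offdiag Q Z).
Proof. by rewrite /kato linearD /= offdiag_pinch // offdiagK // add0r. Qed.

Lemma kato_offdiag Z : kato P Q (offdiag Q Z) = offdiag P (offdiag Q Z).
Proof.
by rewrite /kato pinch_offdiag // offdiagK // linear0 add0r.
Qed.

Lemma kato_lie A Z : (forall i, P i *m A = A *m P i) ->
  (forall i, Q i *m A = A *m Q i) -> kato P Q (lie A Z) = lie A (kato P Q Z).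
Proof.
move=> PA QA; rewrite /kato (pinch_lie Z QA) (pinch_lie _ PA).
rewrite (offdiag_lie Z QA) (offdiag_lie _ PA); move: (pinch P _) => Y.
by rewrite lieDr.
Qed.

Lemma kato_inj Z : lin_mx (kato P Q) \in unitmx -> kato P Q Z = 0 -> Z = 0.
Proof.
move=> uK KZ; apply: (can_inj mxvecK); apply: (can_inj (mulmxK uK)).
by rewrite mul_vec_lin /= KZ !linear0 mul0mx.
Qed.

Lemma kato_surj Z : lin_mx (kato P Q) \in unitmx -> exists Y, kato P Q Y = Z.
Proof.
move=> uK; exists (vec_mx (mxvec Z *m invmx (lin_mx (kato P Q)))).
by rewrite -mx_rV_lin mulmxKV // mxvecK.
Qed.

(** The hypotheses say [D = pinch Q D] and [pinch P D = 0], so both terms of [kato P Q D] vanish. *)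
Lemma pinch_transversal D : lin_mx (kato P Q) \in unitmx ->
  offdiag Q D = 0 -> pinch P D = 0 -> D = 0.
Proof.
move=> uK DQ DP; apply: kato_inj => //; rewrite /kato DQ linear0 addr0.
by move/eqP: DQ; rewrite subr_eq0 => /eqP <-.
Qed.

(** [kato P Q] commutes with transposition and with the bracket by [A], and carries [offdiag Q] to
    [offdiag P]; it therefore intertwines the two maps, and it is invertible. *)
Lemma rank_lie_offdiag A : lin_mx (kato P Q) \in unitmx ->
  (forall i, P i *m A = A *m P i) -> (forall i, Q i *m A = A *m Q i) ->
  \rank (lin_mx (off_lie A Q)) = \rank (lin_mx (off_lie A P)).
Proof.
move=> uK PA QA.
have lK Z : kato P Q (off_lie A Q Z) = off_lie A P (kato P Q Z).
  rewrite /off_lie kato_lie // kato_offdiag tr_kato -[kato P Q Z + _]linearD /=.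
  by rewrite offdiag_kato.
have LK : lin_mx (off_lie A Q) *m lin_mx (kato P Q) =
    lin_mx (kato P Q) *m lin_mx (off_lie A P).
  apply/row_matrixP => i; rewrite rowE [RHS]rowE !mulmxA !mul_rV_lin /= !mxvecK.
  by rewrite lK.
have fK : row_full (lin_mx (kato P Q)) by rewrite row_full_unit.
rewrite -[RHS](eqmxMfull _ fK) -LK mxrankMfree // row_free_unit.
Qed.
End Kato.

(** * Stratification of the critical locus *)

Section MorseBott.
Variables (R : realType) (n s t : nat) (E : 'I_s -> 'M[R]_n) (F : 'I_t -> 'M[R]_n).
Variables (a : 'I_s -> R) (b : 'I_t -> R) (A B : 'M[R]_n).
Hypotheses (famE : spectral_family E) (famF : spectral_family F).
Hypotheses (ainj : injective a) (binj : injective b).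
Hypotheses (eA : A = \sum_i a i *: E i) (eB : B = \sum_j b j *: F j).
Implicit Types X Y M W : 'M[R]_n.
Let f := trace_fun A B.

Let As : A^T = A. Proof. by rewrite eA tr_spectral. Qed.
Let Bs : B^T = B. Proof. by rewrite eB tr_spectral. Qed.

Let P X j := X *m F j *m X^T.

Let famP X : orthogonal_group X -> spectral_family (P X).
Proof. exact: spectral_family_conj. Qed.

Let conjE X : X *m B *m X^T = \sum_j b j *: P X j.
Proof. by rewrite eB spectral_conj. Qed.

(** [X B X^T] has the [P X j] as spectral projections with distinct eigenvalues, so commuting with
    it means commuting with each of them. *)
Let critP X : critical_locus f X <->
  orthogonal_group X /\ forall j, P X j *m A = A *m P X j.
Proof.
rewrite critical_locusP //; split=> -[XX AX]; split=> //.
  by apply/(spectral_comm (famP XX) binj); move/lieP: AX; rewrite conjE.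
by apply/lieP/esym; rewrite conjE; apply/(spectral_comm (famP XX) binj).
Qed.

Lemma smooth_pinch (V : normedModType R) (T : 'I_t -> V -> 'M[R]_n)
    (Z : V -> 'M[R]_n) : (forall j, smooth_on setT (T j)) -> smooth_on setT Z ->
  smooth_on setT (fun x => pinch (fun j => T j x) (Z x)).
Proof.
move=> sT sZ; apply: smooth_sum => j _; apply: smooth_mulmx => //.
exact: smooth_mulmx.
Qed.

Lemma smooth_offdiag (V : normedModType R) (T : 'I_t -> V -> 'M[R]_n)
    (Z : V -> 'M[R]_n) : (forall j, smooth_on setT (T j)) -> smooth_on setT Z ->
  smooth_on setT (fun x => offdiag (fun j => T j x) (Z x)).
Proof.
move=> sT sZ; apply: smooth_add => //; apply: smooth_opp; exact: smooth_pinch.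
Qed.

Lemma smooth_kato (V : normedModType R) (T T' : 'I_t -> V -> 'M[R]_n) :
  (forall j, smooth_on setT (T j)) -> (forall j, smooth_on setT (T' j)) ->
  smooth_on setT (fun x => lin_mx (kato (fun j => T j x) (fun j => T' j x))).
Proof.
move=> sT sT'; apply: smooth_lin_mx => Z; have sZ := @smooth_cst R V _ Z.
apply: smooth_add.
  by apply: smooth_pinch => //; exact: smooth_pinch.
by apply: smooth_offdiag => //; exact: smooth_offdiag.
Qed.

Lemma open_unitmx (V : normedModType R) m (K : V -> 'M[R]_m) :
  smooth_on setT K -> open [set x | K x \in unitmx].
Proof.
move=> sK; rewrite (_ : [set x | _] = (fun x => \det (K x)) @^-1` [set r | r != 0]).
  apply: open_comp; last exact: open_neq.
  move=> x _; apply: (smooth_det _ 0%N) => // i j; exact: smooth_coord.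
by apply/seteqP; split=> x /=; rewrite unitmxE unitfE.
Qed.

Let smooth_conj C : smooth_on setT (fun Y : 'M[R]_n => Y *m C *m Y^T).
Proof.
have sid := @smooth_id R 'M[R]_n.
apply: smooth_mulmx; last exact: smooth_trmx.
by apply: smooth_mulmx => //; exact: smooth_cst.
Qed.

(* The points near X whose spectral projections stay transversal to those of X. *)
Let nbhd X := [set Y | lin_mx (kato (P X) (P Y)) \in unitmx] `&`
  [set Y | lin_mx (kato (P Y) (P X)) \in unitmx].

Let open_nbhd X : open (nbhd X).
Proof.
have sP j : smooth_on setT (fun Y => P Y j) by exact: smooth_conj.
have sX j : smooth_on setT (cst (P X j) : 'M[R]_n -> _) by exact: smooth_cst.
by apply: openI; apply: open_unitmx; exact: smooth_kato.
Qed.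

Let nbhd_refl X : orthogonal_group X -> nbhd X X.
Proof.
move=> XX; suff u : lin_mx (kato (P X) (P X)) \in unitmx by split.
rewrite (_ : lin_mx _ = 1%:M) ?unitmx1 //; apply/row_matrixP => i.
rewrite rowE [RHS]rowE mul_rV_lin /= kato_id ?mulmx1 ?vec_mxK //; exact: famP.
Qed.

(** At a critical point, the codimension of the critical locus. *)
Let rk X := \rank (lin_mx (off_lie A (P X))).

Let rk_nbhd X Y : critical_locus f X -> critical_locus f Y -> nbhd X Y ->
  rk Y = rk X.
Proof.
move=> /critP[XX PX] /critP[YY PY] [uK _].
exact: (rank_lie_offdiag (famP XX) (famP YY)).
Qed.

Let stratum k := [set X | critical_locus f X /\ rk X = k].

Section Chart.
Variable X : 'M[R]_n.
Hypothesis fX : critical_locus f X.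
Let XX : orthogonal_group X. Proof. by have /critP[] := fX. Qed.
Let PXA : forall j, P X j *m A = A *m P X j. Proof. by have /critP[] := fX. Qed.
Let L := row_base (lin_mx (off_lie A (P X))).

(** Coordinates of [[A, offdiag (P X) S]] in the basis [L] of the image of [off_lie A (P X)]; they
    make the target a space of row vectors of length [rk X]. *)
Let coord S : 'rV[R]_(rk X) := mxvec (lie A (offdiag (P X) S)) *m pinvmx L.

Fact coord_linear : linear coord.
Proof.
move=> c Y Z; rewrite /coord offdiag_linear lie_linear linearP /= mulmxDl.
by rewrite -scalemxAl.
Qed.
HB.instance Definition _ := GRing.isLinear.Build R 'M[R]_n 'rV[R]_(rk X) _ coord
  coord_linear.

Let chart Y : 'rV[R]_(rk X) := coord (Y *m B *m Y^T).

Let smooth_chart : smooth_on setT chart.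
Proof.
apply: (smooth_lin_comp (l := coord)) (smooth_conj B).
by move=> Z; exact: (@smooth_linear_mx _ _ _ _ coord 0%N).
Qed.

Let diff_chart Y W : W^T = - W ->
  'd chart Y (W *m Y) = coord (lie W (Y *m B *m Y^T)) :> 'rV[R]_(rk X).
Proof.
move=> Ws; rewrite -deriveE; last exact: smooth_on_differentiable smooth_chart I.
have dY := is_derive_id Y (W *m Y).
have dC := is_derive_mulmx (is_derive_mulmxr B dY) (is_derive_trmx dY).
rewrite velocity // in dC.
by have [_ ->] := is_derive_linear_mx coord dC.
Qed.

(** A symmetric [S] is [S/2 + (S/2)^T], so the bracket is the value of [off_lie] at [S/2]. *)
Let coord_sub S : S^T = S -> (mxvec (lie A (offdiag (P X) S)) <= L)%MS.
Proof.
move=> Ss; rewrite eq_row_base -{1}(half_mulr2n S) mulr2n -{2}Ss -linearZ /=.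
by rewrite -[lie _ _]/(off_lie A (P X) _) -mul_vec_lin submxMl.
Qed.

Let chart_critical Y : nbhd X Y -> orthogonal_group Y ->
  chart Y = 0 <-> critical_locus f Y.
Proof.
move=> [_ uK] YY; set C := Y *m B *m Y^T.
have off_lieC : lie A (offdiag (P X) C) = offdiag (P X) (lie A C).
  by rewrite offdiag_lie.
split=> [Y0|/(critical_locusP As Bs)[_ AC]]; last first.
  by rewrite /chart /coord off_lieC AC !linear0 mul0mx.
apply/(critical_locusP As Bs); split => //.
apply: (pinch_transversal uK).
  (* The bracket lies in the span of [L], so zero coordinates force it to be zero. *)
  rewrite -off_lieC; apply: (can_inj mxvecK); rewrite linear0.
  rewrite -(mulmxKpV (coord_sub (tr_conj Y Bs))) -/(coord C) -/(chart Y).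
  by rewrite Y0 mul0mx.
(* A bracket with [C] has no diagonal blocks for the spectral projections of [C]. *)
by rewrite -/C lieC linearN /= /C conjE pinch_lie_spectral ?oppr0 //; exact: famP.
Qed.

(** A preimage is built backwards: [w] comes from a symmetric [S] at [X], the Kato map transports
    its off-diagonal part to a [Z] at [Y], and inverting the bracket with [Y B Y^T] yields the
    velocity. *)
Let chart_submersion Y : critical_locus f Y -> nbhd X Y ->
  forall w : 'rV[R]_(rk X), exists2 M, tangent_O Y M & 'd chart Y M = w.
Proof.
move=> /critP[YY PYA] [uK _] w.
have /submxP[D wD] : (w *m L <= lin_mx (off_lie A (P X)))%MS.
  by apply: submx_trans (submxMl _ _) _; rewrite eq_row_base.
rewrite mul_rV_lin /= /off_lie in wD.
set S := vec_mx D + _ in wD.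
have Ss : S^T = S by rewrite linearD /= trmxK addrC.
have [Z KZ] := kato_surj (offdiag (P X) S) uK.
(* [Z] and its transpose have the same image under the injective Kato map. *)
have Zs : Z^T = Z.
  apply/eqP; rewrite -subr_eq0; apply/eqP; apply: kato_inj uK _.
  rewrite linearB /= -(tr_kato (famP XX) (famP YY)) KZ tr_offdiag ?Ss ?subrr //.
  exact: famP.
pose W := lie_inv (P Y) b Z.
have Ws : W^T = - W by apply: tr_lie_inv => //; exact: famP.
exists (W *m Y); first by apply/(tangent_OP _ YY); exists W.
rewrite diff_chart // conjE lie_invK //; last exact: famP.
rewrite /coord -[_ - _]/(offdiag (P Y) Z).
(* The off-diagonal parts for [P X] of [offdiag (P Y) Z] and of the Kato image of [Z] agree, and the
   latter is [offdiag (P X) S]. *)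
rewrite -(offdiag_kato _ (famP XX)) KZ offdiagK; last exact: famP.
by rewrite -wD -mulmxA mulmxVp ?mulmx1 // row_base_free.
Qed.

Lemma stratum_chart : exists (U : set 'M[R]_n) (g : 'M[R]_n -> 'rV[R]_(rk X)),
  [/\ open U, U X, smooth_on U g,
      stratum (rk X) `&` U = [set Y | [/\ U Y, orthogonal_group Y & g Y = 0]] &
      forall Y, (stratum (rk X) `&` U) Y ->
        forall w : 'rV[R]_(rk X), exists2 M, tangent_O Y M & 'd g Y M = w].
Proof.
exists (nbhd X), chart; split.
- exact: open_nbhd.
- exact: nbhd_refl.
- by move=> k; apply: Ck_on_sub (smooth_chart k).
- apply/seteqP; split=> Y.
    move=> [[fY _] UY]; have /critP[YY _] := fY.
    by split=> //; apply/chart_critical.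
  move=> [UY YY Y0]; have fY : critical_locus f Y by apply/(chart_critical UY YY).
  by split; [split; [exact: fY|exact: rk_nbhd]|exact: UY].
- by move=> Y [[fY _] UY]; exact: chart_submersion.
Qed.

End Chart.

Lemma trace_fun_morse_bott : morse_bott f.
Proof.
split; first exact: smooth_trace_fun.
  (* The pieces are indexed by the rank, which is also their codimension. *)
  exists nat, stratum, id; split.
  - by move=> i j _ _ [X [[_ <-] [_ <-]]].
  - apply/seteqP; split=> [X fX|X [i _ []] //]; by exists (rk X).
  (* Local constancy of the rank makes each stratum open in the critical locus. *)
  - move=> k; exists (\bigcup_(X in stratum k) nbhd X).
      by apply: bigcup_open => X _; exact: open_nbhd.
    apply/seteqP; split=> X.
      move=> CX; have [/critP[XX _] _] := CX.
      by split; [case: CX|exists X => //; exact: nbhd_refl].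
    by move=> [fX [Y [fY <-] XY]]; split; [exact: fX|exact: rk_nbhd].
  move=> k; split=> [X [/critP[]] //|X [fX <-]].
  exact: stratum_chart.
move=> X fX; have /(critical_locusP As Bs)[XX _] := fX.
apply/seteqP; split=> M.
  move=> kM; have [/(tangent_OP _ XX)[W Ws eM] _] := kM.
  rewrite eM in kM *; apply: (velocity_critical As Bs famE ainj eA) => //.
  by apply/(ker_hessianP As Bs).
move=> tM; have /(tangent_OP _ XX)[W Ws eM] : tangent_O X M.
  by apply: tangent_space_O tM => Y [].
rewrite eM in tM *; apply/(ker_hessianP As Bs) => //.
exact: critical_velocity tM XX.
Qed.
End MorseBott.

(** * Equivalence of the eight conditions *)

Theorem theorem2p13 (R : realType) (n s t : nat)
    (m_ : 'I_s -> nat) (n_ : 'I_t -> nat) (a : 'I_s -> R) (b : 'I_t -> R)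
    (hn : (1 <= n)%N)
    (hm : forall i, (1 <= m_ i)%N) (hn_ : forall j, (1 <= n_ j)%N)
    (Em : (\sum_i m_ i)%N = n) (En : (\sum_j n_ j)%N = n)
    (ha : injective a) (hb : injective b)
    (A B : 'M[R]_n)
    (hA : A = block_diag Em (fun i => (a i)%:M))
    (hB : B = block_diag En (fun j => (b j)%:M)) :
  let f := trace_fun A B in
  let F := critical_locus f in
  (forall X M : 'M[R]_n, F X -> tangent_O X M ->
    [<-> (* i *) tangent_space F X M;
     (* ii *) (A *m M *m B *m X^T + A *m X *m B *m M^T)^T
                = A *m M *m B *m X^T + A *m X *m B *m M^T;
     (* iii *) exists2 W : forall i, 'M[R]_(m_ i),
                 forall i, (W i)^T = W i &
                 M *m B *m X^T + X *m B *m M^T = block_diag Em W;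
     (* iv *) A *m M *m B *m X^T + A *m X *m B *m M^T
                = M *m B *m X^T *m A + X *m B *m M^T *m A;
     (* v *) B *m X^T *m A *m M + B *m M^T *m A *m X
               = X^T *m A *m M *m B + M^T *m A *m X *m B;
     (* vi *) (B *m X^T *m A *m M + B *m M^T *m A *m X)^T
                = B *m X^T *m A *m M + B *m M^T *m A *m X;
     (* vii *) exists2 U : forall j, 'M[R]_(n_ j),
                 forall j, (U j)^T = U j &
                 X^T *m A *m M + M^T *m A *m X = block_diag En U;
     (* viii *) ker_hessian f X M]) /\
  morse_bott f.
Proof.
move=> f F.
have [E famE eA] := block_diag_spectral Em a.
have [G famG eB] := block_diag_spectral En b.
rewrite -hA in eA; rewrite -hB in eB.
have As : A^T = A by rewrite eA tr_spectral.
have Bs : B^T = B by rewrite eB tr_spectral.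
split; last exact: (trace_fun_morse_bott famE famG ha hb eA eB).
move=> X M fX tM; have /(critical_locusP As Bs)[XX AX] := fX.
have /(tangent_OP _ XX)[W Ws eM] := tM.
pose C := X *m B *m X^T.
have PE : M *m B *m X^T + X *m B *m M^T = lie W C by rewrite eM velocity.
have QE : X^T *m A *m M + M^T *m A *m X = X^T *m lie A W *m X.
  by rewrite eM covelocity.
have Ps : (lie W C)^T = lie W C by exact: tr_velocity.
have Qs := tr_covelocity X As Ws.
have e2 : A *m M *m B *m X^T + A *m X *m B *m M^T = A *m lie W C.
  by rewrite -PE mulmxDr !mulmxA.
have e4 : M *m B *m X^T *m A + X *m B *m M^T *m A = lie W C *m A.
  by rewrite -PE mulmxDl.
have e5 : B *m X^T *m A *m M + B *m M^T *m A *m X = B *m (X^T *m lie A W *m X).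
  by rewrite -QE mulmxDr !mulmxA.
have e5' : X^T *m A *m M *m B + M^T *m A *m X *m B = X^T *m lie A W *m X *m B.
  by rewrite -QE mulmxDl.
rewrite e2 e4 e5 e5' PE QE.
(* From here every condition is compared with [[A, [W, C]] = 0]. *)
have h1 : tangent_space F X M <-> lie A (lie W C) = 0.
  rewrite eM in tM *; split=> [tF|AW].
    exact: (critical_velocity As Bs Ws tF XX).
  exact: (velocity_critical As Bs famE ha eA).
have h8 : ker_hessian f X M <-> lie A (lie W C) = 0.
  by rewrite eM; apply: ker_hessianP.
have h2 := symm_mulP As Ps.
have h3 := block_diag_symP Em ha Ps; rewrite -hA in h3.
have h5 := lie_velocity_covelocity W XX AX.
have h6 := symm_mulP Bs Qs.
have h7 := block_diag_symP En hb Qs; rewrite -hB in h7.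
(* Conditions (ii) to (iv) concern [[W, C]] and (v) to (vii) concern [X^T [A, W] X]; the cycle
   crosses between the two sides through [h5]. *)
tfae.
- by move/h1/h2.
- by move/h2/h3.
- by move/h3/lieP.
- by move/lieP/h5/lieP.
- by move/lieP/h6.
- by move/h6/h7.
- by move/h7/h5/h8.
- by move/h8/h1.
Qed.
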